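(* Let $N\ge 3$. The map $[L]\mapsto[P_L]$ is a bijection from the set of similarity classes of strictly convex equilateral $N$-gons to the set of similarity classes of strictly convex equiangular $N$-gons.
   Context: Polygons are planar, labelled, strictly convex, oriented counterclockwise, and considered up to orientation-preserving similarity. Equilateral means all sides have equal length; equiangular means all interior angles are equal. An $N$-sunburst is a collection of $N$ distinct rays from the origin whose convex hull is the plane. In a pair $(A,B)$ of $N$-sunbursts the rays are labelled in counterclockwise cyclic order $A_1,A_3,\dots,A_{2N-1}$ and $B_2,B_4,\dots,B_{2N}$, indices mod $2N$. The regular $N$-sunburst has rays through the $N$th roots of unity. Definition of $[P_L]$. Let $L$ be a strictly convex equilateral $N$-gon, normalized to have unit edge vectors $\beta_2,\beta_4,\dots,\beta_{2N}$ in order. Let $B_k$ be the ray from $0$ containing $\beta_k$; then $B$ is an $N$-sunburst whose outward unit vectors sum to $0$. Let $A$ be the regular $N$-sunburst. There is a unique rotation $B'$ of $B$ about the origin (labels carried along) for which there exist counterclockwise convex $N$-gons with vertices $a_k\in A_k\setminus\{0\}$ ($k$ odd) and $b_k\in B'_k\setminus\{0\}$ ($k$ even) such that $a_{k+1}-a_{k-1}$ is a positive multiple of the inward (toward the origin) direction of $B'_k$ for every even $k$, and $b_{k+1}-b_{k-1}$ is a positive multiple of the outward direction of $A_k$ for every odd $k$. The polygon $P_L$ is the $N$-gon with vertices $b_2,b_4,\dots,b_{2N}$; its similarity class $[P_L]$ depends only on the similarity class $[L]$. *)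

(* Defs.v *)
From HB Require Import structures.
From mathcomp Require Import all_boot all_order all_algebra.
From mathcomp Require Import complex.
From mathcomp Require Import all_classical all_reals all_analysis.

Set Implicit Arguments.
Unset Strict Implicit.
Unset Printing Implicit Defensive.

Import Order.TTheory GRing.Theory Num.Theory.
Local Open Scope ring_scope.
Local Open Scope complex_scope.
Local Open Scope classical_set_scope.

(* The Euclidean plane is R[i].  A labelled N-gon is given by its vertices,
   indexed by 'I_N and read cyclically by means of ordS (i |-> i + 1 mod N)
   and ord_pred (i |-> i - 1 mod N). *)
Definition polygon (R : realType) (N : nat) := 'I_N -> R[i].

Section Polygons.
Variables (R : realType) (N : nat).
Implicit Types (z : R[i]) (v L P : polygon R N).

Definition dot z z' : R := complex.Re (conjc z * z').
Definition cross z z' : R := complex.Im (conjc z * z').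

Definition unitv z : R[i] := z / `|z|.

Definition side v (i : 'I_N) : R[i] := v (ordS i) - v i.

(* Every vertex off a given side lies strictly to the left of the line that
   supports this side: v is a strictly convex polygon, oriented
   counterclockwise. *)
Definition strictly_convex_ccw v : Prop :=
  forall i j : 'I_N, j != i -> j != ordS i ->
    0 < cross (side v i) (v j - v i).

Definition equilateral v : Prop := forall i j : 'I_N, `|side v i| = `|side v j|.

(* The unoriented angle, in [0, pi], between the two sides that meet at v i;
   for a strictly convex polygon, it is the interior angle. *)
Definition interior_angle v (i : 'I_N) : R :=
  acos (dot (unitv (v (ord_pred i) - v i)) (unitv (v (ordS i) - v i))).

Definition equiangular v : Prop :=
  forall i j : 'I_N, interior_angle v i = interior_angle v j.

Definition similar_polygons v v' : Prop :=
  exists c d : R[i], c != 0 /\ forall i, v' i = c * v i + d.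

Definition similarity_class v : set (polygon R N) := [set v' | similar_polygons v v'].

Definition equilateral_classes : set (set (polygon R N)) :=
  similarity_class @` [set v | strictly_convex_ccw v /\ equilateral v].

Definition equiangular_classes : set (set (polygon R N)) :=
  similarity_class @` [set v | strictly_convex_ccw v /\ equiangular v].

Definition ray (d : R[i]) : set (R[i]) :=
  [set z | exists2 t : R, 0 <= t & z = t%:C * d].

Definition positive_multiple z (d : R[i]) : Prop :=
  exists2 t : R, 0 < t & z = t%:C * d.

(* An N-sunburst is given by the outward unit vectors of its rays.  The rays
   A_1, A_3, ..., A_(2N-1) and B_2, B_4, ..., B_(2N) are both indexed by 'I_N:
   the index j stands for the odd label 2j+1 and for the even label 2j+2.
   Hence the neighbours of the even label k = 2j+2 are k-1 ~ j and
   k+1 ~ ordS j, and those of the odd label k = 2j+1 are k-1 ~ ord_pred j and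
   k+1 ~ j. *)
Definition regular_sunburst (j : 'I_N) : R[i] :=
  let t : R := 2 * pi * j%:R / N%:R in cos t +i* sin t.

(* Dividing the sides of L by their lengths amounts to normalizing the
   equilateral polygon L to have unit sides. *)
Definition edge_sunburst L (j : 'I_N) : R[i] := unitv (side L j).

(* a and b are the polygons with vertices a_k, k odd, and b_k, k even, that
   are attached to the sunbursts with outward unit vectors A and B. *)
Definition dual_polygons (A B : 'I_N -> R[i]) (a b : polygon R N) : Prop :=
  [/\ strictly_convex_ccw a,
      strictly_convex_ccw b,
      forall j, a j \in ray (A j) `\ 0 /\ b j \in ray (B j) `\ 0,
      forall j, positive_multiple (a (ordS j) - a j) (- B j)
    & forall j, positive_multiple (b j - b (ord_pred j)) (A j)].

Definition rotate (u : R[i]) (B : 'I_N -> R[i]) : 'I_N -> R[i] :=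
  fun j => u * B j.

(* The rotation of the plane by the unit complex number u turns the edge
   sunburst of L into one that carries polygons dual to the regular one. *)
Definition admissible_rotation L (u : R[i]) : Prop :=
  `|u| = 1 /\
  exists a b, dual_polygons regular_sunburst (rotate u (edge_sunburst L)) a b.

(* P is a polygon P_L; it is determined by L up to a positive scaling only.
   There is no such P unless exactly one rotation is admissible. *)
Definition is_PL L P : Prop :=
  exists u, unique (admissible_rotation L) u /\
  exists a, dual_polygons regular_sunburst (rotate u (edge_sunburst L)) a P.

(* [L] |-> [P_L], as the direct image of the class C.  It is a similarity
   class exactly when some P_L exists for some L in C, and when all the P_L,
   for L in C, are similar: that PL_map maps classes to classes is the
   well-definedness of [L] |-> [P_L]. *)
Definition PL_map (C : set (polygon R N)) : set (polygon R N) :=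
  \bigcup_(L in C) \bigcup_(P in is_PL L) similarity_class P.

End Polygons.

Arguments equilateral_classes : clear implicits.
Arguments equiangular_classes : clear implicits.

(* Main.v *)
Require Import Defs.
From mathcomp Require Import all_boot all_order all_algebra.
From mathcomp Require Import complex.
From mathcomp Require Import all_classical all_reals all_analysis.
From mathcomp Require Import ring lra zify.

(** Let [A] be the regular sunburst, [h = 2 pi / N], and let the B_j be unit
    vectors.  Putting b_j = t_j B_j and a_j = s_j A_j, the dual polygons exist iff every
    angle alpha_j from B_j to A_j lies in (0, pi - h) and the product of the
    ratios sin (alpha_j + h) / sin alpha_j is 1 (both polygons close up under
    this same condition; s_j is then proportional to 1 / (t_j sin alpha_j)).
    Rotating [B] shifts all the alpha_j by the same amount and each ratio is
    decreasing in alpha_j, so at most one rotation is admissible.  For the edge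
    directions B_j = cis phi_j of an equilateral polygon, the vanishing of their
    sum forces the numbers j h - phi_j to lie in an interval shorter than
    pi - h, and the intermediate value theorem gives an admissible rotation.

    The sides of P_L point along the A_j, so P_L is equiangular.  Conversely
    the B_j are the directions from the origin to the vertices of P_L, and
    their sum is 0: the origin is the geometric median of P_L.  Its uniqueness
    yields injectivity.  Its existence yields surjectivity: the median of an
    equiangular polygon is not a vertex and lies inside, and the directions
    from it to the vertices are the edges of the polygon [L] sought. *)

Set Implicit Arguments.
Unset Strict Implicit.
Unset Printing Implicit Defensive.

Import Order.TTheory GRing.Theory Num.Theory.
Import numFieldNormedType.Exports.
Local Open Scope ring_scope.
Local Open Scope complex_scope.
Local Open Scope classical_set_scope.

(** * The Euclidean plane *)

Section Plane.
Variable R : realType.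
Implicit Types (z w u d : R[i]) (t r x y : R).

Definition cis t : R[i] := cos t +i* sin t.

(** The modulus with values in [R], since [|z|] has type [R[i]]; [normE] links the two. *)
Definition nm z : R := Num.sqrt (dot z z).

Lemma eqC z w :
  complex.Re z = complex.Re w -> complex.Im z = complex.Im w -> z = w.
Proof. by case: z w => [a b] [c d] /= -> ->. Qed.

Lemma ReD z w : complex.Re (z + w) = complex.Re z + complex.Re w.
Proof. by case: z w => [a b] [c d]. Qed.

Lemma ImD z w : complex.Im (z + w) = complex.Im z + complex.Im w.
Proof. by case: z w => [a b] [c d]. Qed.

Lemma ReN z : complex.Re (- z) = - complex.Re z.
Proof. by case: z. Qed.

Lemma ImN z : complex.Im (- z) = - complex.Im z.
Proof. by case: z. Qed.

Lemma ReM z w : complex.Re (z * w) =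
  complex.Re z * complex.Re w - complex.Im z * complex.Im w.
Proof. by case: z w => [a b] [c d]. Qed.

Lemma ImM z w : complex.Im (z * w) =
  complex.Re z * complex.Im w + complex.Im z * complex.Re w.
Proof. by case: z w => [a b] [c d]. Qed.

Lemma dotE z w :
  dot z w = complex.Re z * complex.Re w + complex.Im z * complex.Im w.
Proof. by case: z w => [a b] [c d]; rewrite /dot /=; ring. Qed.

Lemma crossE z w :
  cross z w = complex.Re z * complex.Im w - complex.Im z * complex.Re w.
Proof. by case: z w => [a b] [c d]; rewrite /cross /=; ring. Qed.

Lemma ReC t : complex.Re t%:C = t. Proof. by []. Qed.
Lemma ImC t : complex.Im t%:C = 0. Proof. by []. Qed.
Lemma Re0 : complex.Re (0 : R[i]) = 0. Proof. by []. Qed.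
Lemma Im0 : complex.Im (0 : R[i]) = 0. Proof. by []. Qed.
Lemma Re1 : complex.Re (1 : R[i]) = 1. Proof. by []. Qed.
Lemma Im1 : complex.Im (1 : R[i]) = 0. Proof. by []. Qed.
Lemma Recis t : complex.Re (cis t) = cos t. Proof. by []. Qed.
Lemma Imcis t : complex.Im (cis t) = sin t. Proof. by []. Qed.

Definition cplx := (dotE, crossE, ReM, ImM, ReD, ImD, ReN, ImN, ReC, ImC,
  Re0, Im0, Re1, Im1, Recis, Imcis).

Lemma crossC z w : cross z w = - cross w z. Proof. by rewrite !cplx; ring. Qed.
Lemma crossDl z z' w : cross (z + z') w = cross z w + cross z' w.
Proof. by rewrite !cplx; ring. Qed.
Lemma crossDr z z' w : cross w (z + z') = cross w z + cross w z'.
Proof. by rewrite !cplx; ring. Qed.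
Lemma crossNl z w : cross (- z) w = - cross z w.
Proof. by rewrite !cplx; ring. Qed.
Lemma crossNr z w : cross w (- z) = - cross w z.
Proof. by rewrite !cplx; ring. Qed.
Lemma crossZl t z w : cross (t%:C * z) w = t * cross z w.
Proof. by rewrite !cplx; ring. Qed.
Lemma crossZr t z w : cross w (t%:C * z) = t * cross w z.
Proof. by rewrite !cplx; ring. Qed.
Lemma crosszz z : cross z z = 0. Proof. by rewrite !cplx; ring. Qed.
Lemma cross0 z : cross z 0 = 0. Proof. by rewrite !cplx; ring. Qed.
Lemma crossM u z w : cross (u * z) (u * w) = dot u u * cross z w.
Proof. by rewrite !cplx; ring. Qed.

Lemma dotC z w : dot z w = dot w z. Proof. by rewrite !cplx; ring. Qed.
Lemma dotDr z z' w : dot w (z + z') = dot w z + dot w z'.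
Proof. by rewrite !cplx; ring. Qed.
Lemma dotNr z w : dot w (- z) = - dot w z.
Proof. by rewrite !cplx; ring. Qed.
Lemma dotNl z w : dot (- z) w = - dot z w.
Proof. by rewrite !cplx; ring. Qed.
Lemma dotZr t z w : dot w (t%:C * z) = t * dot w z.
Proof. by rewrite !cplx; ring. Qed.
Lemma dotZl t z w : dot (t%:C * z) w = t * dot z w.
Proof. by rewrite !cplx; ring. Qed.
Lemma dot0 z : dot z 0 = 0. Proof. by rewrite !cplx; ring. Qed.
Lemma dotM u z w : dot (u * z) (u * w) = dot u u * dot z w.
Proof. by rewrite !cplx; ring. Qed.
Lemma dot_ge0 z : 0 <= dot z z.
Proof. by rewrite dotE; nra. Qed.
Lemma dot_eq0 z : (dot z z == 0) = (z == 0).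
Proof.
apply/eqP/eqP => [|->]; last by rewrite dot0.
by rewrite dotE => H; apply: eqC; rewrite /=; nra.
Qed.
Lemma dot_gt0 z : z != 0 -> 0 < dot z z.
Proof. by move=> z0; rewrite lt_def dot_eq0 z0 dot_ge0. Qed.

Lemma dot_sum (I : finType) (P : pred I) (F : I -> R[i]) z :
  dot z (\sum_(i | P i) F i) = \sum_(i | P i) dot z (F i).
Proof. by elim/big_rec2: _ => [|i y1 y2 _ <-]; rewrite ?dot0 ?dotDr. Qed.

Lemma cross_sum (I : finType) (P : pred I) (F : I -> R[i]) z :
  cross z (\sum_(i | P i) F i) = \sum_(i | P i) cross z (F i).
Proof. by elim/big_rec2: _ => [|i y1 y2 _ <-]; rewrite ?cross0 ?crossDr. Qed.

Lemma dot_cross_sqr z w : cross z w ^+ 2 + dot z w ^+ 2 = dot z z * dot w w.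
Proof. by rewrite !cplx; ring. Qed.

Lemma nm_ge0 z : 0 <= nm z. Proof. exact: sqrtr_ge0. Qed.
Lemma nm_gt0 z : z != 0 -> 0 < nm z.
Proof. by move=> z0; rewrite sqrtr_gt0 dot_gt0. Qed.
Lemma nm0 : nm 0 = 0. Proof. by rewrite /nm dot0 sqrtr0. Qed.
Lemma nm_eq0 z : (nm z == 0) = (z == 0).
Proof.
apply/eqP/eqP => [|->]; last exact: nm0.
by move/eqP; apply: contraTeq => /nm_gt0 /lt0r_neq0.
Qed.
Lemma nm_sqr z : nm z ^+ 2 = dot z z.
Proof. by rewrite sqr_sqrtr ?dot_ge0. Qed.
Lemma normE z : `|z| = (nm z)%:C.
Proof. by rewrite normc_def /nm dotE !expr2. Qed.
Lemma nmM z w : nm (z * w) = nm z * nm w.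
Proof. by apply: complexI; rewrite rmorphM /= -!normE normrM. Qed.
Lemma nmN z : nm (- z) = nm z.
Proof. by apply: complexI; rewrite -!normE normrN. Qed.
Lemma nmZ t z : 0 <= t -> nm (t%:C * z) = t * nm z.
Proof.
by move=> t0; rewrite nmM; congr (_ * _); rewrite /nm !cplx mulr0 addr0 -expr2
  sqrtr_sqr ger0_norm.
Qed.
Lemma nmD z w : nm (z + w) <= nm z + nm w.
Proof. by rewrite -lecR rmorphD /= -!normE ler_normD. Qed.
Lemma nm1P u : (`|u| = 1) <-> (dot u u = 1).
Proof.
rewrite normE -nm_sqr; split=> [H|H].
  have -> : nm u = 1 by apply: complexI.
  by rewrite expr1n.
have -> // : nm u = 1.
by apply/eqP; rewrite -(@eqrXn2 _ 2%N) ?nm_ge0 ?H ?expr1n.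
Qed.

Lemma unitvE z : unitv z = (nm z)^-1%:C * z.
Proof.
by rewrite /unitv normE mulrC; congr (_ * _); rewrite fmorphV.
Qed.
Lemma unitvK z : z = (nm z)%:C * unitv z.
Proof.
have [->|z0] := eqVneq z 0; first by rewrite unitvE !mulr0.
rewrite unitvE mulrA -rmorphM mulfV ?mul1r //; first by rewrite nm_eq0.
Qed.
Lemma unitv_dot z : z != 0 -> dot (unitv z) (unitv z) = 1.
Proof.
move=> z0; rewrite unitvE dotZl dotZr -nm_sqr expr2 !mulrA.
have n0 : nm z != 0 by rewrite nm_eq0.
by field.
Qed.
Lemma unitvM z w : unitv (z * w) = unitv z * unitv w.
Proof. by rewrite /unitv normrM invfM mulrACA. Qed.
Lemma unitvZ t z : 0 < t -> unitv (t%:C * z) = unitv z.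
Proof.
move=> t0; have nt : nm t%:C = t.
  by rewrite /nm !cplx mulr0 addr0 -expr2 sqrtr_sqr gtr0_norm.
by rewrite unitvM unitvE nt -rmorphM mulVf ?gt_eqF // rmorph1 mul1r.
Qed.
Lemma unitvN z : unitv (- z) = - unitv z.
Proof. by rewrite /unitv normrN mulNr. Qed.
Lemma unitv_id u : dot u u = 1 -> unitv u = u.
Proof. by move=> /nm1P u1; rewrite /unitv u1 divr1. Qed.
Lemma cross_unitvr z w : cross z w = nm w * cross z (unitv w).
Proof. by rewrite -crossZr -unitvK. Qed.

Lemma parallel_dot z w : dot z z = 1 -> cross z w = 0 -> w = (dot z w)%:C * z.
Proof.
case: z w => [a b] [c d]; rewrite !cplx /= => z1 /eqP; rewrite subr_eq0 => /eqP zw.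
apply: eqC; rewrite !cplx /=.
- by rewrite -[LHS]mul1r -z1; ring: zw.
- by rewrite -[LHS]mul1r -z1; ring: zw.
Qed.

Lemma cramer z w d :
  (cross z w)%:C * d = (cross z d)%:C * w + (cross w d)%:C * - z.
Proof. by apply: eqC; rewrite !cplx; ring. Qed.

Lemma dot_cis x y : dot (cis x) (cis y) = cos (y - x).
Proof. by rewrite !cplx cosB; ring. Qed.
Lemma cross_cis x y : cross (cis x) (cis y) = sin (y - x).
Proof. by rewrite !cplx sinB; ring. Qed.
Lemma cis_dot x : dot (cis x) (cis x) = 1.
Proof. by rewrite dot_cis subrr cos0. Qed.
Lemma cisD x y : cis (x + y) = cis x * cis y.
Proof. by apply: eqC; rewrite !cplx ?cosD ?sinD; ring. Qed.
Lemma cis2pi x : cis (x + 2 * pi) = cis x.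
Proof. by rewrite /cis mulr_natl cosD2pi sinD2pi. Qed.
Lemma cispi x : cis (x + pi) = - cis x.
Proof. by rewrite /cis cosDpi sinDpi. Qed.
Lemma cis0 : cis 0 = 1.
Proof. by rewrite /cis cos0 sin0. Qed.

(** Turns a positive cross product into an angle bound: of the three half-turns between -pi and 2
    pi, only the middle one has positive sine inside. *)
Lemma sin_gt0_range x : 0 < sin x -> - pi <= x -> x < 2 * pi -> 0 < x < pi.
Proof.
move=> s0 x1 x2; apply/andP; split; rewrite ltNge; apply/negP => x3.
- suff : 0 <= sin (- x) by rewrite sinN; lra.
  by apply: sin_ge0_pi; apply/andP; split; lra.
- have : 0 <= sin (x - pi) by apply: sin_ge0_pi; apply/andP; split; lra.
  by move: s0; rewrite -{1}(subrK pi x) sinDpi; lra.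
Qed.

Lemma sin_lt0_pi x : pi < x < 2 * pi -> sin x < 0.
Proof.
move=> /andP[x1 x2]; rewrite -(subrK pi x) sinDpi oppr_lt0.
by apply: sin_gt0_pi; apply/andP; split; lra.
Qed.

Lemma cis_inj x y : cis x = cis y -> `|x - y| < 2 * pi -> x = y.
Proof.
move=> H; rewrite ltr_norml => /andP[l1 l2].
apply/eqP; rewrite -subr_eq0; set d := x - y in l1 l2 *.
have : cos d = 1 by rewrite -dot_cis H cis_dot.
have -> : d = (d / 2) *+ 2 by rewrite -mulr_natr; field.
rewrite cos_mulr2n cos2sin2 => E.
have {E} s0 : sin (d / 2) = 0.
  by apply/eqP; rewrite -sqrf_eq0; apply/eqP; move: E; rewrite -mulr_natr; lra.
have [d0|d0|->] := ltgtP d 0; last by rewrite mul0r mul0rn.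
- suff : 0 < sin (- (d / 2)) by rewrite sinN s0 oppr0 ltxx.
  by apply: sin_gt0_pi; apply/andP; split; lra.
- suff : 0 < sin (d / 2) by rewrite s0 ltxx.
  by apply: sin_gt0_pi; apply/andP; split; lra.
Qed.

Lemma polar u : dot u u = 1 -> exists2 x, 0 <= x < 2 * pi & u = cis x.
Proof.
case: u => a b; rewrite dotE /= => ab.
have a1 : -1 <= a <= 1 by apply/andP; split; nra.
have ca : cos (acos a) = a by rewrite acosK // in_itv.
have sa : sin (acos a) ^+ 2 = b ^+ 2 by rewrite sin2cos2 ca; lra.
have p0 := acos_ge0 a1; have ppi := acos_lepi a1; have pi0 := @pi_gt0 R.
have s0 : 0 <= sin (acos a) by apply: sin_ge0_pi; rewrite p0.
have [b0|b0] := leP 0 b.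
  exists (acos a); first by apply/andP; split; lra.
  apply: eqC; rewrite /= ?ca //.
  by apply/eqP; rewrite -(@eqrXn2 _ 2%N) // sa.
exists (2 * pi - acos a).
  apply/andP; split; first lra.
  suff : acos a != 0 by move=> ?; have := lt_def (acos a) 0; lra.
  by apply/eqP => E; move: sa; rewrite E sin0; nra.
rewrite addrC cis2pi; apply: eqC; rewrite /= ?cosN ?sinN ?ca //.
apply/eqP; rewrite -eqr_oppLR; apply/eqP.
by apply/eqP; rewrite -(@eqrXn2 _ 2%N) ?sqrrN ?sa //; lra.
Qed.

Lemma polar_from a z : z != 0 ->
  exists r x, [/\ 0 < r, a <= x < a + 2 * pi & z = r%:C * cis x].
Proof.
move=> z0; have /polar[x /andP[x0 x1] E] :
    dot (cis (- a) * unitv z) (cis (- a) * unitv z) = 1.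
  by rewrite dotM cis_dot mul1r unitv_dot.
exists (nm z), (a + x); split; [exact: nm_gt0|apply/andP; split; lra|].
by rewrite cisD -E [cis a * _]mulrA -cisD subrr cis0 mul1r -unitvK.
Qed.

(** Follows the direction of a diagonal when a side is added to it. The cross products comparing the
    sum with its two summands are positive, which puts its argument between theirs. *)
Lemma cone_polar x y r t : 0 < r -> 0 < t -> x < y < x + pi ->
  exists r' c, [/\ 0 < r', x < c < y & r%:C * cis x + t%:C * cis y = r'%:C * cis c].
Proof.
move=> r0 t0 /andP[xy yx]; set z := _ + _.
have s0 : 0 < sin (y - x) by apply: sin_gt0_pi; apply/andP; split; lra.
have c1 : cross (cis x) z = t * sin (y - x).
  by rewrite /z crossDr !crossZr crosszz cross_cis mulr0 add0r.
have c2 : cross z (cis y) = r * sin (y - x).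
  by rewrite /z crossDl !crossZl crosszz cross_cis mulr0 addr0.
have z0 : z != 0.
  by apply/eqP => E; move: c1; rewrite E cross0 => /eqP; rewrite eq_sym gt_eqF ?mulr_gt0.
have [r' [c [r'0 /andP[c0 c3] E]]] := polar_from x z0.
exists r', c; split=> //.
have : 0 < sin (c - x).
  by rewrite -(pmulr_rgt0 _ r'0) -cross_cis -crossZr -E c1 mulr_gt0.
move=> /sin_gt0_range H; have /andP[h1 h2] : 0 < c - x < pi by apply: H; have := @pi_gt0 R; lra.
have : 0 < sin (y - c).
  by rewrite -(pmulr_rgt0 _ r'0) -cross_cis -crossZl -E c2 mulr_gt0.
move=> /sin_gt0_range H'; have /andP[] : 0 < y - c < pi by apply: H'; have := @pi_gt0 R; lra.
by move=> ? ?; apply/andP; split; lra.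
Qed.

End Plane.

(** * Directions of the sides of a convex polygon *)

Section Cyclic.
Variable M : nat.
Local Notation N := M.+3.

(** Periodic extension to all naturals, so that arguments of directions can be lifted to [R] and
    inductions need not wrap around. *)
Definition cyc (T : Type) (v : 'I_N -> T) (n : nat) : T := v (inord (n %% N)).

Lemma inord_modE n : (inord (n %% N) : 'I_N) = (n %% N)%N :> nat.
Proof. by rewrite inordK // ltn_mod. Qed.

Lemma cyc_ord T (v : 'I_N -> T) (i : 'I_N) : cyc v i = v i.
Proof. by rewrite /cyc modn_small // inord_val. Qed.

Lemma cyc_mod T (v : 'I_N -> T) n : cyc v (n %% N) = cyc v n.
Proof. by rewrite /cyc modn_mod. Qed.

Lemma cycD T (v : 'I_N -> T) n : cyc v (n + N) = cyc v n.
Proof. by rewrite /cyc modnDr. Qed.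

Lemma cyc0 T (v : 'I_N -> T) : cyc v N = cyc v 0.
Proof. exact: (cycD v 0). Qed.

Lemma cycS T (v : 'I_N -> T) n : v (ordS (inord (n %% N))) = cyc v n.+1.
Proof.
by congr v; apply/val_inj; rewrite /= !inord_modE -addn1 modnDml addn1.
Qed.

Lemma cyc_ordS T (v : 'I_N -> T) (i : 'I_N) : v (ordS i) = cyc v i.+1.
Proof. by rewrite -cycS modn_small // inord_val. Qed.


End Cyclic.

(** * Lifting the arguments of the sides to the real line *)

Section Lift.
Variables (R : realType) (M : nat).
Local Notation N := M.+3.
Implicit Types (v : polygon R N) (V e : nat -> R[i]) (phi : nat -> R).

Lemma sideE v n : side v (inord (n %% N)) = cyc v n.+1 - cyc v n.
Proof. by rewrite /side cycS. Qed.

Lemma cyc_side v n : cyc (side v) n = cyc v n.+1 - cyc v n.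
Proof. exact: sideE. Qed.

Lemma strictly_convexP v : strictly_convex_ccw v <->
  forall n m, (1 < m < N)%N ->
    0 < cross (cyc v n.+1 - cyc v n) (cyc v (n + m) - cyc v n).
Proof.
split=> H.
- move=> n m /andP[m1 m2]; rewrite -sideE; apply: H.
  + apply/eqP => /(congr1 val); rewrite /= !inord_modE -[X in _ = X %[mod _] -> _]addn0.
    by move/eqP; rewrite eqn_modDl mod0n modn_small // => /eqP m0; move: m1; rewrite m0.
  + apply/eqP => /(congr1 val); rewrite /= !inord_modE -(addn1 (_ %% _)) modnDml.
    move/eqP; rewrite eqn_modDl !modn_small // => /eqP m0.
    by move: m1; rewrite m0.
- move=> i j ji jSi.
  have [k kE kN] : exists2 k, (i + k = j %[mod N])%N & (k < N)%N.
    exists ((j + (N - i)) %% N)%N; last by rewrite ltn_mod.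
    rewrite modnDmr addnCA subnKC ?modnDr //; exact: ltnW.
  have -> : v j = cyc v (i + k).
    by rewrite -cyc_mod kE cyc_mod cyc_ord.
  rewrite /side cyc_ordS -[v i]cyc_ord; apply: H; rewrite kN andbT.
  case: k kE kN => [|[|k]] // kE _.
  + move: kE; rewrite addn0 !modn_small // => /val_inj E.
    by rewrite E eqxx in ji.
  + move: kE; rewrite addn1 [RHS]modn_small // => E.
    by case/eqP: jSi; apply/val_inj.
Qed.

(** A lift of the direction map with winding number one. The first clause excludes star polygons,
    which also turn left at every vertex. *)
Definition is_lift phi e : Prop :=
  [/\ forall n, phi (n + N)%N = phi n + 2 * pi,
      forall n, 0 < phi n.+1 - phi n < pi
    & forall n, exists2 r, 0 < r & e n = r%:C * cis (phi n)].

Lemma lift_lt phi e m n : is_lift phi e -> (m < n)%N -> phi m < phi n.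
Proof.
move=> [_ H _]; elim: n => // n IH; rewrite ltnS leq_eqVlt => /orP[/eqP->|/IH mn].
  by have := H n; lra.
by have := H n; lra.
Qed.

Lemma lift_cross_next phi e n : is_lift phi e -> 0 < cross (e n) (e n.+1).
Proof.
move=> [_ H1 H2]; have [r r0 ->] := H2 n; have [r' r'0 ->] := H2 n.+1.
by rewrite crossZl crossZr cross_cis !mulr_gt0 // sin_gt0_pi.
Qed.

Lemma cross_path_gt0 V u a b : (a < b)%N ->
  (forall k, (a <= k < b)%N -> 0 < cross u (V k.+1 - V k)) ->
  0 < cross u (V b - V a).
Proof.
elim: b => // b IH; rewrite ltnS leq_eqVlt => /orP[/eqP<-|ab] H.
  by apply: H; rewrite leqnn ltnSn.
rewrite -(subrKA (V b)) crossDr addr_gt0 //.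
  by apply: H; rewrite ltnSn ltnW.
by apply: IH => // k /andP[k1 k2]; apply: H; rewrite k1 ltnS ltnW.
Qed.

(* The height of the k-th vertex above the n-th side increases with k, then
   decreases, and it vanishes at both ends of a period. *)
Lemma lift_convex v phi :
  is_lift phi (fun n => cyc v n.+1 - cyc v n) -> strictly_convex_ccw v.
Proof.
pose e n := cyc v n.+1 - cyc v n.
move=> lift; have [H1 H2 H3] : is_lift phi e := lift.
apply/strictly_convexP => n m /andP[m1 mN]; rewrite -/(e n).
have en k : 0 < sin (phi k - phi n) -> 0 < cross (e n) (e k).
  have [r r0 ->] := H3 n; have [r' r'0 ->] := H3 k => sk.
  by rewrite crossZl crossZr cross_cis !mulr_gt0.
have en' k : 0 < sin (phi n - phi k) -> 0 < cross (- e n) (e k).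
  have [r r0 ->] := H3 n; have [r' r'0 ->] := H3 k => sk.
  by rewrite crossNl -crossC crossZl crossZr cross_cis !mulr_gt0.
(* As long as side n + m does not descend, climb from vertex n + 1 to vertex n + m; otherwise
   descend from there to vertex n + N, which is vertex n. *)
have [le|gt] := leP (phi (n + m)%N) (phi n + pi).
- rewrite -(subrKA (cyc v n.+1)) crossDr -/(e n) crosszz addr0.
  apply: cross_path_gt0 => [|k /andP[k1 k2]]; first by rewrite -addn1 ltn_add2l.
  apply: en; apply: sin_gt0_pi.
  have := lift_lt lift k1; have := lift_lt lift k2; lra.
- rewrite -[cyc v n]cycD -opprB crossNr -crossNl.
  apply: cross_path_gt0 => [|k /andP[k1 k2]]; first by rewrite ltn_add2l.
  apply: en'; rewrite -opprB sinN oppr_gt0; apply: sin_lt0_pi.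
  have : phi (n + m)%N <= phi k.
    by move: k1; rewrite leq_eqVlt => /orP[/eqP->|/(lift_lt lift)/ltW].
  have := lift_lt lift k2; rewrite H1; lra.
Qed.

Lemma polar_eq (r r' x y : R) :
  0 < r -> 0 < r' -> r%:C * cis x = r'%:C * cis y -> cis x = cis y.
Proof.
move=> r0 r'0 /(congr1 (@unitv R)).
by rewrite !unitvZ // !unitv_id ?cis_dot.
Qed.

Lemma cross_neq0 (z w : R[i]) : 0 < cross z w -> z != 0.
Proof.
by move=> h; apply/eqP => z0; move: h; rewrite z0 crossC cross0 oppr0 ltxx.
Qed.

(* The direction of [v n - v 0] turns by less than pi as n runs from 1 to N-1;
   comparing it with the direction of the sides shows that the total turning of
   the sides is 2 pi and not a higher multiple. *)
Lemma convex_lift v : strictly_convex_ccw v ->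
  exists phi, is_lift phi (fun n => cyc v n.+1 - cyc v n).
Proof.
move=> /strictly_convexP hull; have pi0 := @pi_gt0 R.
pose e n := cyc v n.+1 - cyc v n.
have eD n : e (n + N)%N = e n by rewrite /e -addSn !cycD.
have emod n : e (n %% N)%N = e n.
  by rewrite /e cyc_mod -addn1 -[n.+1]addn1 /cyc modnDml.
have turn n : 0 < cross (e n) (e n.+1).
  have := hull n 2%N isT.
  rewrite addn2 -/(e n) -(subrKA (cyc v n.+1)) crossDr -/(e n) -/(e n.+1) crosszz.
  by rewrite addr0.
have /choice[g gP] n : exists g, 0 < g < pi /\
    forall x r, 0 < r -> e n = r%:C * cis x ->
      exists2 r', 0 < r' & e n.+1 = r'%:C * cis (x + g).
  have en0 := cross_neq0 (turn n).
  have [r [x [r0 _ E]]] := polar_from 0 en0.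
  have en1 := cross_neq0 (turn n.+1).
  have [r' [y [r'0 /andP[y1 y2] E']]] := polar_from x en1.
  have := turn n; rewrite E E' crossZl crossZr cross_cis !pmulr_rgt0 // => s0.
  exists (y - x); split; first by apply: sin_gt0_range; lra.
  move=> x' t t0 E''; exists r' => //.
  by rewrite cisD (polar_eq t0 r0 (esym E'')) -cisD addrC subrK.
have [r0 [x0 [r00 _ E0]]] := polar_from 0 (cross_neq0 (turn 0%N)).
(* Reducing the index modulo N makes the chosen turning angles periodic. *)
pose gap n := g (n %% N)%N.
pose phi n := x0 + \sum_(k < n) gap k.
have phiS n : phi n.+1 = phi n + gap n.
  by rewrite /phi big_ord_recr /= addrA.
have phi0 : phi 0%N = x0 by rewrite /phi big_ord0 addr0.
have gap0 n : 0 < gap n < pi by have [] := gP (n %% N)%N.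
have ephi n : exists2 r, 0 < r & e n = r%:C * cis (phi n).
  elim: n => [|n [r rp IH]]; first by exists r0; rewrite // phi0.
  have [_ H] := gP (n %% N)%N; rewrite phiS.
  have [|r' r'0 E] := H (phi n) r rp; first by rewrite emod.
  exists r' => //; rewrite -E -[LHS]emod -[RHS]emod.
  by rewrite -[(n %% N).+1]addn1 modnDml addn1.
(* [psi] is the argument of the diagonal from vertex 0 to vertex k + 1. Its bounds propagate because
   vertex 0 is left of side k + 1 and vertex k + 2 is left of side 0. *)
have fan k : (k.+1 < N)%N -> exists r psi,
    [/\ 0 < r, cyc v k.+1 - cyc v 0 = r%:C * cis psi,
        phi 0%N <= psi <= phi k, phi k < psi + pi & psi < phi 0%N + pi].
  elim: k => [_|k IH kN].
    by exists r0, (phi 0%N); split=> //; rewrite ?phi0 ?lexx //; lra.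
  have [|r [psi [rp E /andP[p1 p2] p3 p4]]] := IH; first exact: ltnW.
  have [t tp Et] := ephi k.+1; have := gap0 k; have := phiS k => pS gk.
  have s1 : 0 < sin (phi k.+1 - psi).
    have := hull k.+1 (N - k.+1)%N.
    rewrite subnKC ?(ltnW (ltnW kN)) // cyc0 -/(e k.+1) Et -opprB E.
    rewrite crossNr crossZl crossZr cross_cis -mulrN -mulrN -sinN opprB.
    rewrite !pmulr_rgt0 //; apply; apply/andP; split; last by rewrite ltn_subrL.
    by rewrite ltn_subRL addn1.
  have /andP[_ p5] : 0 < phi k.+1 - psi < pi by apply: sin_gt0_range; lra.
  have [|r' [c [r'0 /andP[c1 c2] E']]] := @cone_polar R psi (phi k.+1) r t rp tp.
    by apply/andP; split; lra.
  have Ec : cyc v k.+2 - cyc v 0 = r'%:C * cis c.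
    by rewrite -E' -E -Et /e [RHS]addrC subrKA.
  exists r', c; split=> //; [lra|lra|].
  have := hull 0%N k.+2 kN; rewrite add0n Ec -/(e 0%N) E0 crossZl crossZr cross_cis.
  rewrite !pmulr_rgt0 // -phi0 => s2.
  have : 0 < c - phi 0%N < pi by apply: sin_gt0_range; lra.
  lra.
have [r [psi [rp E /andP[p1 p2] p3 p4]]] := fan M.+1 (ltnSn _).
have [t tp Et] := ephi M.+2; have gM := gap0 M.+1; have pM := phiS M.+1.
(* The last side runs from vertex N - 1 back to vertex 0, opposite to the diagonal; the bounds on
   [psi] leave no other multiple of 2 pi. *)
have E1 : phi M.+2 = psi + pi.
  apply: cis_inj; last by rewrite ltr_norml; apply/andP; split; lra.
  apply: (polar_eq tp rp); rewrite -Et cispi mulrN -E opprB /e.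
  by rewrite cyc0.
have [t' t'p Et'] := ephi N; have gM2 := gap0 M.+2; have pM2 := phiS M.+2.
have E2 : phi N = phi 0%N + 2 * pi.
  apply: cis_inj; last by rewrite ltr_norml; apply/andP; split; lra.
  rewrite cis2pi; apply: (polar_eq t'p r00); rewrite -Et' phi0 -E0.
  by rewrite -[N]add0n eD.
exists phi; split=> //.
- elim=> [|n IH]; first by rewrite add0n.
  by rewrite addSn !phiS IH /gap modnDr; ring.
- by move=> n; rewrite phiS addrC addKr.
Qed.

Lemma similar_of_sides v v' c : c != 0 ->
  (forall i, side v' i = c * side v i) -> similar_polygons v v'.
Proof.
move=> c0 H; exists c, (cyc v' 0 - c * cyc v 0); split=> // i.
rewrite -(cyc_ord v) -(cyc_ord v').
elim: (nat_of_ord i) => [|n IH]; first by rewrite addrC subrK.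
have := H (inord (n %% N)); rewrite !sideE => /eqP.
by rewrite subr_eq IH => /eqP->; ring.
Qed.

Lemma polygon_of_sides (B : 'I_N -> R[i]) :
  \sum_j B j = 0 -> exists v, forall j, side v j = B j.
Proof.
move=> B0; exists (fun i : 'I_N => \sum_(0 <= k < i) cyc B k) => j.
rewrite /side /=; have [jN|] := ltnP j.+1 N.
  by rewrite modn_small // big_nat_recr //= [X in X - _]addrC addrK cyc_ord.
move=> Nj; have jE : j = M.+2 :> nat.
  by apply/eqP; rewrite eqn_leq -ltnS ltn_ord.
(* The last side has to lead back to vertex 0: this is where the vanishing sum enters. *)
rewrite jE modnn big_geq // sub0r -[B j]cyc_ord jE.
have : \sum_(0 <= k < N) cyc B k = 0.
  by rewrite big_mkord -[RHS]B0; apply: eq_bigr => i _; rewrite cyc_ord.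
by rewrite big_nat_recr //= addrC => /eqP; rewrite addr_eq0 => /eqP ->.
Qed.

Lemma lift_interior_angle v phi n : is_lift phi (fun n => cyc v n.+1 - cyc v n) ->
  cyc (interior_angle v) n.+1 = pi - (phi n.+1 - phi n).
Proof.
move=> [_ H2 H3]; rewrite -cycS /interior_angle.
rewrite ordSK -/(side v (ordS _)) -opprB -/(side v (inord _)).
rewrite (cycS (side v)) cyc_side sideE.
have [r r0 ->] := H3 n; have [r' r'0 ->] := H3 n.+1.
rewrite unitvN !unitvZ // !unitv_id ?cis_dot // dotNl dot_cis.
have := H2 n; set x := phi n.+1 - _ => /andP[x1 x2].
by rewrite acosN ?cos_geN1 ?cos_le1 // cosK // in_itv /= !ltW.
Qed.

End Lift.

(** * Dual polygons and sunbursts *)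

Section Jordan.
Variable R : realType.

(** Jordan's inequality. By the mean value theorem the slopes of the chords of sine over [0, x] and
    [x, pi / 2] are two cosines, the second one smaller. *)
Lemma jordan_sin (x : R) : 0 < x < pi / 2 -> 2 * x < pi * sin x.
Proof.
move=> /andP[x0 x1].
have csin (a b : R) : {within `[a, b], continuous (@sin R)}.
  by apply: continuous_subspaceT => ?; exact: continuous_sin.
have [c1] := @MVT R sin cos 0 x x0 (fun t _ => is_derive_sin t) (@csin _ _).
have [c2] := @MVT R sin cos x (pi / 2) x1 (fun t _ => is_derive_sin t) (@csin _ _).
rewrite sin0 subr0 sin_pihalf !in_itv /= => /andP[c3 c4] E2 /andP[c5 c6].
rewrite subr0 => E1; have pi0 := @pi_gt0 R.
have : cos c2 < cos c1 by rewrite ltr_cos ?in_itv /=; try apply/andP; try split; lra.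
move: (cos c1) (cos c2) (sin x) E1 E2 => u v s -> E2 uv.
have : v * (pi / 2 - x) < u * (pi / 2 - x) by rewrite ltr_pM2r //; lra.
rewrite -E2 => u1; have : 1 < u * (pi / 2) by lra.
by move: u1 => _ u1; nra.
Qed.

End Jordan.

(** * The closing condition for dual polygons, and the spread of directions with zero sum *)

Section Sunbursts.
Variables (R : realType) (M : nat).
Local Notation N := M.+3.
Implicit Types (B E : 'I_N -> R[i]) (t X Y : 'I_N -> R).

Local Notation A := (@regular_sunburst R N).

Definition step : R := 2 * pi / N%:R.
Local Notation h := step.

Lemma stepN : h * N%:R = 2 * pi.
Proof. by rewrite /step divfK // pnatr_eq0. Qed.

Lemma step_gt0 : 0 < h.
Proof. by rewrite /step divr_gt0 ?mulr_gt0 ?pi_gt0. Qed.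

Lemma step_lt_pi : h < pi.
Proof.
have := stepN; have := @pi_gt0 R; have := step_gt0.
have : 3 <= N%:R :> R by rewrite ler_nat.
by move: (N%:R) => n n3 h0 p0 E; nra.
Qed.

Lemma sin_step : 0 < sin h.
Proof. by apply: sin_gt0_pi; rewrite step_gt0 step_lt_pi. Qed.

Lemma cis_mod n : cis ((n %% N)%:R * h) = cis (n%:R * h).
Proof.
rewrite [in RHS](divn_eq n N) natrD natrM mulrDl -mulrA [N%:R * h]mulrC stepN.
elim: (n %/ N)%N => [|q IH]; first by rewrite mul0r add0r.
rewrite IH -cis2pi; congr cis; rewrite -natr1; ring.
Qed.

Lemma cyc_regular n : cyc A n = cis (n%:R * h).
Proof.
rewrite -cis_mod /cyc /regular_sunburst inord_modE /cis.
by have -> : 2 * pi * (n %% N)%:R / N%:R = (n %% N)%:R * h by rewrite /step; ring.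
Qed.

Lemma regularE (j : 'I_N) : A j = cis (j%:R * h).
Proof. by rewrite -cyc_ord cyc_regular. Qed.

Lemma regularSE (j : 'I_N) : A (ordS j) = cis (j%:R * h + h).
Proof. by rewrite cyc_ordS cyc_regular -addn1 natrD mulrDl mul1r. Qed.

Lemma regular_dot (j : 'I_N) : dot (A j) (A j) = 1.
Proof. by rewrite regularE cis_dot. Qed.

Lemma cross_regular (j : 'I_N) : cross (A j) (A (ordS j)) = sin h.
Proof. by rewrite regularE regularSE cross_cis; congr sin; ring. Qed.

(* Writing b_j = t_j B_j, the last condition says that b_(j+1) - b_j is
   parallel to A_(j+1). *)
Definition balanced B t : Prop :=
  [/\ forall j, 0 < cross (B j) (A j), forall j, 0 < cross (B j) (A (ordS j)),
      forall j, 0 < t j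
    & forall j, t (ordS j) * cross (B (ordS j)) (A (ordS j)) =
                t j * cross (B j) (A (ordS j))].

Lemma ray_pos (d z : R[i]) : z \in ray d `\ 0 -> exists2 r, 0 < r & z = r%:C * d.
Proof.
rewrite inE => -[[r r0 ->]] /= H; exists r => //.
rewrite lt_def r0 andbT; apply/eqP => E; apply: H; rewrite E.
by rewrite rmorph0 mul0r.
Qed.

Lemma pos_ray (d : R[i]) (r : R) : d != 0 -> 0 < r -> r%:C * d \in ray d `\ 0.
Proof.
move=> d0 r0; rewrite inE; split; first by exists r => //; exact: ltW.
move=> /= /eqP; rewrite mulf_eq0 (negPf d0) orbF => /eqP [E].
by rewrite E ltxx in r0.
Qed.

Lemma unit_neq0 (d : R[i]) : dot d d = 1 -> d != 0.
Proof. by move=> d1; rewrite -dot_eq0 d1 oner_eq0. Qed.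

(** Crossing the sides of [a] with A_j and A_(j+1) gives the two signs, and [a] is then dropped;
    crossing the sides of [b] with A_(j+1) gives the balance equation. *)
Lemma dual_balanced B a b : (forall j, dot (B j) (B j) = 1) ->
  dual_polygons A B a b ->
  exists2 t, balanced B t & forall j, b j = (t j)%:C * B j.
Proof.
move=> B1 [_ _ ab Da Db].
have /choice[s sP] j : exists r : R, 0 < r /\ a j = r%:C * A j.
  by have [r r0 E] := ray_pos (ab j).1; exists r.
have /choice[t tP] j : exists r : R, 0 < r /\ b j = r%:C * B j.
  by have [r r0 E] := ray_pos (ab j).2; exists r.
exists t; last by move=> j; have [] := tP j.
have [X0 Y0] : (forall j, 0 < cross (B j) (A j)) /\
    (forall j, 0 < cross (B j) (A (ordS j))).
  have H j : exists2 p, 0 < p &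
      p * cross (B j) (A j) = s (ordS j) * sin h /\
      p * cross (B j) (A (ordS j)) = s j * sin h.
    have [p p0] := Da j; have [_ ->] := sP j; have [_ ->] := sP (ordS j) => E.
    exists p => //; split.
      have /(congr1 (cross (A j))) := E.
      rewrite crossDr !(crossNr, crossZr) crosszz cross_regular.
      by rewrite [cross (A j) (B j)]crossC; lra.
    have /(congr1 (cross (A (ordS j)))) := E.
    rewrite crossDr !(crossNr, crossZr) crosszz.
    rewrite [cross (A _) (B j)]crossC [cross _ (A j)]crossC cross_regular; lra.
  split=> j; have [p p0 [e1 e2]] := H j; rewrite -(pmulr_rgt0 _ p0) ?e1 ?e2;
    by rewrite mulr_gt0 ?sin_step //; have [] := sP (ordS j); have [] := sP j.
split=> // j; first by have [] := tP j.
have [q q0] := Db (ordS j); rewrite ordSK; have [_ ->] := tP j.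
have [_ ->] := tP (ordS j) => /(congr1 (cross (A (ordS j)))).
rewrite crossDr crossNr !crossZr crosszz.
rewrite [cross (A _) (B j)]crossC [cross (A _) (B (ordS j))]crossC; lra.
Qed.

(** Multiplying the balance equations around the cycle cancels [t]. *)
Lemma balanced_prod B t : balanced B t ->
  \prod_j cross (B j) (A j) = \prod_j cross (B j) (A (ordS j)).
Proof.
move=> [_ _ t0 H].
have T0 : \prod_j t j != 0 by apply/prodf_neq0 => j _; rewrite gt_eqF.
apply: (mulfI T0); rewrite -!big_split /=.
by rewrite (reindex_inj (@ordS_inj N)); apply: eq_bigr => j _; exact: H.
Qed.

Lemma cyc_ind (P : 'I_N -> Prop) :
  P ord0 -> (forall j, P j -> P (ordS j)) -> forall j, P j.
Proof.
move=> P0 PS j; rewrite -[j]inord_val -(modn_small (ltn_ord j)).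
elim: (nat_of_ord j) => [|n IH]; last first.
  by have := PS _ IH; congr P; exact: (cycS id).
by congr P : P0; apply: val_inj; rewrite /= inordK.
Qed.

(** The balance equation determines each value of [t] from the preceding one, so only the value at
    [ord0] is free. *)
Lemma balanced_proportional B t t' : balanced B t -> balanced B t' ->
  exists2 k, 0 < k & forall j, t' j = k * t j.
Proof.
move=> [X0 Y0 t0 H] [_ _ t'0 H'].
exists (t' ord0 / t ord0); first by rewrite divr_gt0.
apply: cyc_ind => [|j IH]; first by rewrite divfK ?gt_eqF.
apply: (mulIf (lt0r_neq0 (X0 (ordS j)))).
by rewrite H' IH -mulrA -H mulrA.
Qed.

(** By [key], the sign of Im w decides for all j at once which of two mixed products of cross
    products is larger. The two product conditions make their products over j equal, so w is real;
    positivity then leaves w = 1. *)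
Lemma balanced_rotation B t t' (w : R[i]) : (forall j, dot (B j) (B j) = 1) ->
  dot w w = 1 -> balanced B t -> balanced (fun j => w * B j) t' -> w = 1.
Proof.
move=> B1 w1 b b'.
have P := balanced_prod b; have P' := balanced_prod b'.
move: b b' => [X0 Y0 _ _] [X'0 Y'0 _ _].
have key j : cross (B j) (A (ordS j)) * cross (w * B j) (A j) -
    cross (B j) (A j) * cross (w * B j) (A (ordS j)) = - (sin h * complex.Im w).
  transitivity (- (dot (B j) (B j) * cross (A j) (A (ordS j)) * complex.Im w)).
    by rewrite !cplx; ring.
  by rewrite cross_regular B1 mul1r.
have [w0|w0|w0] := ltgtP (complex.Im w) 0.
- suff : \prod_j (cross (B j) (A j) * cross (w * B j) (A (ordS j))) <
         \prod_j (cross (B j) (A (ordS j)) * cross (w * B j) (A j)).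
    by rewrite !big_split /= P P' ltxx.
  apply: ltr_prod => [|j _]; first by apply/hasP; exists ord0.
  rewrite mulr_ge0 ?ltW //=; have := key j; have := sin_step; nra.
- suff : \prod_j (cross (B j) (A (ordS j)) * cross (w * B j) (A j)) <
         \prod_j (cross (B j) (A j) * cross (w * B j) (A (ordS j))).
    by rewrite !big_split /= P P' ltxx.
  apply: ltr_prod => [|j _]; first by apply/hasP; exists ord0.
  rewrite mulr_ge0 ?ltW //=; have := key j; have := sin_step; nra.
- have := X0 ord0; have := X'0 ord0.
  have -> : w = (complex.Re w)%:C by case: (w) w0 => ? ? /= ->.
  rewrite crossZl => p1 p2.
  have r0 : 0 < complex.Re w by rewrite -(pmulr_lgt0 _ p2).
  move: w1; rewrite dotE w0 mul0r addr0 => r1.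
  suff -> : complex.Re w = 1 by [].
  by nra.
Qed.

(** The recursion defines [t] from the value 1 at index 0; it is consistent after one turn because
    the two products agree. *)
Lemma closing X Y : (forall j, 0 < X j) -> (forall j, 0 < Y j) ->
  \prod_j X j = \prod_j Y j ->
  exists2 t, forall j, 0 < t j & forall j, t (ordS j) * X (ordS j) = t j * Y j.
Proof.
move=> X0 Y0 XY; pose T n := \prod_(0 <= k < n) (cyc Y k / cyc X k.+1).
have x0 n : 0 < cyc X n by exact: X0.
have y0 n : 0 < cyc Y n by exact: Y0.
have TS n : T n.+1 * cyc X n.+1 = T n * cyc Y n.
  by rewrite /T big_nat_recr //= -mulrA divfK // gt_eqF.
have TN : T N = 1.
  have -> : T N = (\prod_j Y j) / \prod_j X (ordS j).
    rewrite -prodf_div /T big_mkord; apply: eq_bigr => j _.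
    by rewrite cyc_ord cyc_ordS.
  rewrite -XY [X in X / _](reindex_inj (@ordS_inj N)) divff //.
  by apply/prodf_neq0 => j _; rewrite gt_eqF.
exists (fun j : 'I_N => T j) => j.
  by rewrite /T prodr_gt0 // => k _; rewrite divr_gt0.
rewrite [X (ordS j)]cyc_ordS -(cyc_ord Y) -TS; congr (_ * _).
change (T (j.+1 %% N)%N = T j.+1).
have [jN|] := ltnP j.+1 N; first by rewrite modn_small.
move=> Nj; have -> : j.+1 = N by apply/eqP; rewrite eqn_leq ltn_ord.
by rewrite modnn TN /T big_geq.
Qed.

Lemma balanced_dual B t phi : (forall j, dot (B j) (B j) = 1) ->
  balanced B t -> is_lift M phi (cyc B) ->
  exists a, dual_polygons A B a (fun j => (t j)%:C * B j).
Proof.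
move=> B1 [X0 Y0 t0 H] lift.
(* With this choice, balance of [t] makes a_(j+1) - a_j parallel to B_j. *)
pose s j : R := (t j * cross (B j) (A j))^-1.
have s0 j : 0 < s j by rewrite invr_gt0 mulr_gt0.
have sH j : s (ordS j) * cross (B j) (A (ordS j)) = s j * cross (B j) (A j).
  rewrite /s H; have := t0 j; have := X0 j; have := Y0 j => y0 x0 tj0.
  by field; rewrite !gt_eqF.
pose a (j : 'I_N) := (s j)%:C * A j; exists a.
pose b (j : 'I_N) := (t j)%:C * B j.
have Da j : exists2 p, 0 < p & a (ordS j) - a j = p%:C * - B j.
  have E : cross (B j) (a (ordS j) - a j) = 0.
    by rewrite crossDr crossNr !crossZr sH subrr.
  exists (- dot (B j) (a (ordS j) - a j)); last first.
    by rewrite rmorphN mulNr mulrN opprK; exact: parallel_dot.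
  rewrite -(pmulr_lgt0 _ (X0 j)) mulNr -mulrN -crossC -crossZr -parallel_dot //.
  by rewrite crossDr crossNr !crossZr crosszz mulr0 subr0 cross_regular
    mulr_gt0 ?sin_step.
have Db j : exists2 q, 0 < q & b (ordS j) - b j = q%:C * A (ordS j).
  have E : cross (A (ordS j)) (b (ordS j) - b j) = 0.
    rewrite crossDr crossNr !crossZr; have := H j.
    by rewrite [cross (A _) (B j)]crossC [cross (A _) (B (ordS j))]crossC; lra.
  exists (dot (A (ordS j)) (b (ordS j) - b j)); last first.
    by apply: parallel_dot; rewrite // regular_dot.
  rewrite -(pmulr_lgt0 _ (Y0 j)) -crossZr -parallel_dot ?regular_dot //.
  rewrite crossDr crossNr !crossZr crosszz mulr0 subr0 mulr_gt0 //.
  by rewrite -(cyc_ord B) cyc_ordS; exact: (lift_cross_next _ lift).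
have [l1 l2 l3] := lift; have pi0 := @pi_gt0 R.
split.
(* The sides of [a] point along - B_j, whence the added pi. Side j of [b] points along A_(j+1),
   whence [n.+1] in the next lift. *)
- apply: (@lift_convex _ _ _ (fun n => phi n + pi)); split=> n.
  + by rewrite l1; ring.
  + by have := l2 n; lra.
  + rewrite -cyc_side; have [p p0 E] := Da (inord (n %% N)).
    have [r r0 E'] := l3 n; exists (p * r); first exact: mulr_gt0.
    by rewrite /cyc /side E -/(cyc B n) E' cispi rmorphM -mulrA !mulrN.
- apply: (@lift_convex _ _ _ (fun n => n.+1%:R * h)); split=> n.
  + by rewrite -addSn natrD mulrDl [N%:R * h]mulrC stepN.
  + have := step_gt0; have := step_lt_pi; rewrite -[n.+2%:R]natr1; lra.
  + rewrite -cyc_side; have [q q0 E] := Db (inord (n %% N)).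
    by exists q => //; rewrite /cyc /side E cycS cyc_regular.
- move=> j; split; apply: pos_ray => //; apply: unit_neq0 => //.
  exact: regular_dot.
- exact: Da.
- move=> j; have [q q0] := Db (ord_pred j); rewrite ord_predK => E.
  by exists q.
Qed.

(** The sector conditions let the argument of B_j be chosen at j h - x with 0 < x < pi - h. This
    choice gives the period 2 pi and confines each step to (2 h - pi, pi); the last hypothesis makes
    the steps positive. *)
Lemma sectors_lift B : (forall j, dot (B j) (B j) = 1) ->
  (forall j, 0 < cross (B j) (A j)) -> (forall j, 0 < cross (B j) (A (ordS j))) ->
  (forall j, 0 < cross (B j) (B (ordS j))) -> exists phi, is_lift M phi (cyc B).
Proof.
move=> B1 X0 Y0 BB; have pi0 := @pi_gt0 R; have h0 := step_gt0; have hpi := step_lt_pi.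
have /choice[al alP] j : exists x, 0 < x < pi - h /\ B j = cis (j%:R * h - x).
  have [r [x [r0 xr E]]] := polar_from (j%:R * h - pi) (unit_neq0 (B1 j)).
  have Bx : B j = cis x by rewrite -(unitv_id (B1 j)) E unitvZ // unitv_id ?cis_dot.
  exists (j%:R * h - x); split; last by rewrite Bx; congr cis; ring.
  have := X0 j; rewrite Bx regularE cross_cis => s1.
  have := Y0 j; rewrite Bx regularSE cross_cis => s2.
  have : 0 < j%:R * h - x < pi by apply: sin_gt0_range; lra.
  have : 0 < j%:R * h + h - x < pi by apply: sin_gt0_range; lra.
  lra.
pose phi n := n%:R * h - cyc al n.
have Bphi n : cyc B n = cis (phi n).
  rewrite {1}/cyc (alP _).2 inord_modE -/(cyc al n) /phi.
  by rewrite !cisD cis_mod.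
exists phi; split=> n.
- by rewrite /phi cycD natrD mulrDl [N%:R * h]mulrC stepN; ring.
- have := BB (inord (n %% N)); rewrite cycS -/(cyc B n) !Bphi cross_cis.
  have a1 := (alP (inord (n %% N))).1; have a2 := (alP (inord (n.+1 %% N))).1.
  rewrite -/(cyc al n) -/(cyc al n.+1) in a1 a2.
  rewrite /phi -natr1 mulrDl mul1r => s0.
  apply: sin_gt0_range => //; lra.
- by exists 1; rewrite // Bphi mul1r.
Qed.

Lemma sum_cyc (F : 'I_N -> R[i]) n : \sum_(k < N) cyc F (n + k) = \sum_j F j.
Proof.
elim: n => [|n IH].
  by apply: eq_bigr => j _; rewrite add0n cyc_ord.
rewrite -IH big_ord_recr [RHS]big_ord_recl /= addn0 addSnnS cycD addrC.
by congr (_ + _); apply: eq_bigr => k _; rewrite /bump /= add1n addSnnS.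
Qed.

Lemma cos_near (x y : R) : `|x| <= y -> y <= pi -> cos y <= cos x.
Proof.
move=> xy ypi; rewrite -(cos_norm x).
have := xy; rewrite le_eqVlt => /orP[/eqP->//|lt].
by have := normr_ge0 x => x0; rewrite ltW // ltr_cos // in_itv /=; apply/andP; split; lra.
Qed.

(* If the m+1 directions phi_i, ..., phi_(i+m) spanned a wider arc, then the
   other N-m+1 =: N-r directions (endpoints included) would lie in so narrow
   an arc that their sum could not be cancelled by the r = m-1 remaining unit
   vectors. *)
Lemma arc_bound E phi i m : (forall j, dot (E j) (E j) = 1) -> \sum_j E j = 0 ->
  is_lift M phi (cyc E) -> (m < N)%N ->
  phi (i + m)%N - phi i < m%:R * h + pi - h.
Proof.
move=> E1 E0 lift mN; have [l1 l2 l3] := lift; have pi0 := @pi_gt0 R.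
have h0 := step_gt0; have hpi := step_lt_pi.
case: m mN => [|[|r]] mN.
- by rewrite addn0 subrr; lra.
- by rewrite addn1 mul1r; have := l2 i; lra.
rewrite ltNge; apply/negP => ge.
(* [d] is the width of the complementary arc, from direction i + m to direction i + N, and [c] is
   its bisector. The number m - 1 of directions outside this arc is [q] below. *)
pose d := phi i + 2 * pi - phi (i + r.+2)%N.
pose c := phi (i + r.+2)%N + d / 2.
have d0 : 0 < d.
  have := @lift_lt _ _ _ _ (i + r.+2)%N (i + N)%N lift.
  by rewrite ltn_add2l mN l1 /d => /(_ isT); lra.
pose n : R := N%:R; pose q : R := r.+1%:R.
have nh : h * n = 2 * pi := stepN.
have q1 : 1 <= q by rewrite /q ler1n.
have dq : d <= pi - q * h.
  by move: ge; rewrite -natr1 -/q /d; lra.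
have n0 : 0 < n by rewrite /n ltr0n.
pose x := q * h / 2.
have x0 : 0 < x < pi / 2.
  by rewrite /x; apply/andP; split; nra.
have J := jordan_sin x0.
have Eun k : cyc E k = cis (phi k).
  have [t t0 Et] := l3 k.
  have : dot (cyc E k) (cyc E k) = 1 by exact: E1.
  rewrite Et dotZl dotZr cis_dot mulr1 => t1.
  suff -> : t = 1 by rewrite mul1r.
  by apply/eqP; rewrite -(@eqrXn2 _ 2%N) ?ltW // expr1n expr2 t1.
have S0 : \sum_(k < N) cos (phi (i.+1 + k)%N - c) = 0.
  have := @dot_sum R 'I_N xpredT (fun k => cyc E (i.+1 + k)) (cis c).
  rewrite sum_cyc E0 dot0 => S0; rewrite [RHS]S0; apply: eq_bigr => k _.
  by rewrite Eun dot_cis.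
(* Project the zero sum on [cis c]: [q] terms are at least -1, and the others, within pi / 2 - x of
   [c], are at least sin x. *)
have : q * -1 + (n - q) * sin x <= 0.
  rewrite -S0 (bigID (fun k : 'I_N => (k < r.+1)%N)) /=.
  have rN : (r.+1 <= N)%N by exact: ltnW (ltnW mN).
  apply: lerD.
  - have -> : q * -1 = \sum_(k < N | (k < r.+1)%N) (-1 : R).
      rewrite -(big_ord_widen _ (fun=> -1 : R) rN) sumr_const card_ord.
      by rewrite -mulr_natl.
    by apply: ler_sum => k _; exact: cos_geN1.
  - have -> : (n - q) * sin x = \sum_(k < N | ~~ (k < r.+1)%N) sin x.
      have : n * sin x = \sum_(k < N) sin x by rewrite sumr_const card_ord mulr_natl.
      rewrite (bigID (fun k : 'I_N => (k < r.+1)%N)) /=.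
      rewrite -(big_ord_widen _ (fun=> sin x) rN) sumr_const card_ord -mulr_natl.
      by rewrite -/q; lra.
    apply: ler_sum => k; rewrite -leqNgt => rk.
    have -> : sin x = cos (pi / 2 - x) by rewrite -cosN opprB cosBpihalf.
    apply: cos_near; last by lra.
    have p1 : phi (i + r.+2)%N <= phi (i.+1 + k)%N.
      move: rk; rewrite leq_eqVlt => /orP[/eqP<-|rk]; first by rewrite addSnnS.
      by apply/ltW/(lift_lt lift); rewrite addSnnS ltn_add2l.
    have p2 : phi (i.+1 + k)%N <= phi (i + N)%N.
      rewrite addSnnS; have := ltn_ord k; rewrite leq_eqVlt => /orP[/eqP->//|kN].
      by apply/ltW/(lift_lt lift); rewrite ltn_add2l.
    move: p2; rewrite l1 ler_norml => p2.
    by rewrite /c /x; apply/andP; split; rewrite /d in dq *; lra.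
(* Jordan's inequality gives sin x > 2 q / n, while n - q > n / 2, so the projection would be
   positive. *)
have qn : 2 * q < n by nra.
have J2 : 2 * q < n * sin x.
  by move: J; rewrite /x -(ltr_pM2r n0); move: (sin _) => s; nra.
move: (sin x) J2 => s J2; nra.
Qed.

End Sunbursts.

(** * Existence of the rotation *)

Section Rotation.
Variables (R : realType) (M : nat).
Local Notation N := M.+3.
Local Notation h := (step R M).
Local Notation A := (@regular_sunburst R N).

Lemma continuous_prod_sin (c : 'I_N -> R) :
  continuous (fun x => \prod_j sin (c j - x)).
Proof.
apply: (@continuous_big R _ *%R 1 xpredT (@mul_continuous R)) => j _ x.
apply: (@continuous_comp _ _ _ (fun x => c j - x) sin); last exact: continuous_sin.
by apply: continuousB; [exact: cvg_cst|exact: cvg_id].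
Qed.

(* The rotation is found by the intermediate value theorem on the interval of
   those x that put every B_j in the sector where b_j may lie; at each end of
   it exactly one of the two products vanishes. *)
Lemma balanced_exists (E : 'I_N -> R[i]) phi : (forall j, dot (E j) (E j) = 1) ->
  \sum_j E j = 0 -> is_lift M phi (cyc E) ->
  exists x t, balanced (fun j => cis x * E j) t.
Proof.
move=> E1 E0 lift; have pi0 := @pi_gt0 R; have h0 := step_gt0 R M.
have hpi := step_lt_pi R M; have [l1 l2 l3] := lift.
pose D (j : 'I_N) : R := j%:R * h - phi j.
have osc i j : D i - D j < pi - h.
  have [ij|ji] := leqP i j.
    have := @arc_bound R M E phi i (j - i)%N E1 E0 lift.
    rewrite subnKC // natrB // /D => /(_ (leq_ltn_trans (leq_subr _ _) (ltn_ord j))).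
    lra.
  (* For j < i the arc runs from i around to j + N; the N extra steps [h] cancel the added 2 pi. *)
  have := @arc_bound R M E phi i (j + N - i)%N E1 E0 lift.
  have iN : (i <= j + N)%N by rewrite (leq_trans (ltnW (ltn_ord i))) ?leq_addl.
  have mN : (j + N - i < N)%N by rewrite ltn_subLR // ltn_add2r.
  rewrite subnKC // natrB // natrD l1 => /(_ mN).
  by have := stepN R M; rewrite /D; lra.
have EE j : E j = cis (phi j).
  have [r r0 Er] := l3 j; rewrite cyc_ord in Er.
  by rewrite -(unitv_id (E1 j)) Er unitvZ // unitv_id ?cis_dot.
have [im _ imax] := @arg_maxP _ R 'I_N ord0 xpredT D isT.
have [in_ _ imin] := @arg_minP _ R 'I_N ord0 xpredT D isT.
have {}imax j : D j <= D im by exact: imax.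
have {}imin j : D in_ <= D j by exact: imin.
pose X x := \prod_j sin (D j - x); pose Y x := \prod_j sin (D j + h - x).
(* Rotation by x replaces every [D j] by [D j - x]; these all lie in (0, pi - h) exactly when a < x
   < b. *)
pose a := D im - (pi - h); pose b := D in_.
have ab : a < b by have := osc im in_; rewrite /a /b; lra.
have [|||c] := @IVT R (fun x => Y x - X x) a b 0; first exact: ltW.
- apply: continuous_subspaceT => x; apply: continuousB;
    exact: continuous_prod_sin.
- have -> : Y a = 0.
    rewrite /Y (bigD1 im) //= [X in sin X](_ : _ = pi) ?sinpi ?mul0r //.
    by rewrite /a; ring.
  have -> : X b = 0.
    by rewrite /X (bigD1 in_) //= subrr sin0 mul0r.
  have Xa : 0 < X a.
    apply: prodr_gt0 => j _; apply: sin_gt0_pi; rewrite /a.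
    by have := osc im j; have := imax j; lra.
  have Yb : 0 < Y b.
    apply: prodr_gt0 => j _; apply: sin_gt0_pi; rewrite /b.
    by have := osc j in_; have := imin j; lra.
  rewrite sub0r subr0 ge_min le_max oppr_le0 ltW //=.
  by rewrite (ltW Yb) orbT.
rewrite in_itv /= => /andP[ca cb] /eqP; rewrite subr_eq0 => /eqP XY.
have ca' : a < c.
  rewrite lt_def ca andbT; apply/eqP => ac.
  have : 0 < X a.
    apply: prodr_gt0 => j _; apply: sin_gt0_pi; rewrite /a.
    by have := osc im j; have := imax j; lra.
  have -> : X a = 0; last by rewrite ltxx.
  rewrite -ac -XY ac /Y (bigD1 im) //= [X in sin X](_ : _ = pi) ?sinpi ?mul0r //.
  by rewrite /a; ring.
have cb' : c < b.
  rewrite lt_def cb andbT; apply/eqP => ac.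
  have : 0 < Y b.
    apply: prodr_gt0 => j _; apply: sin_gt0_pi; rewrite /b.
    by have := osc j in_; have := imin j; lra.
  have -> : Y b = 0; last by rewrite ltxx.
  by rewrite ac XY -ac /X (bigD1 in_) //= subrr sin0 mul0r.
have XE j : cross (cis c * E j) (A j) = sin (D j - c).
  by rewrite EE -cisD regularE cross_cis /D; congr sin; ring.
have YE j : cross (cis c * E j) (A (ordS j)) = sin (D j + h - c).
  by rewrite EE -cisD regularSE cross_cis /D; congr sin; ring.
have X0 j : 0 < cross (cis c * E j) (A j).
  rewrite XE; apply: sin_gt0_pi; have := imax j; have := imin j.
  by rewrite /a in ca'; rewrite /b in cb'; lra.
have Y0 j : 0 < cross (cis c * E j) (A (ordS j)).
  rewrite YE; apply: sin_gt0_pi; have := imax j; have := imin j.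
  by rewrite /a in ca'; rewrite /b in cb'; lra.
have [|t t0 H] := closing X0 Y0.
  rewrite (eq_bigr _ (fun j _ => XE j)) (eq_bigr _ (fun j _ => YE j)).
  by rewrite -/(X c) -/(Y c).
by exists c, t.
Qed.

End Rotation.

(** * The geometric median *)

Section Median.
Variable R : realType.
Implicit Types (z w d x : R[i]).

Lemma Re_le_nm z : `|complex.Re z| <= nm z.
Proof.
rewrite -sqrtr_sqr ler_wsqrtr // dotE -!expr2 lerDl.
by rewrite sqr_ge0.
Qed.

Lemma Im_le_nm z : `|complex.Im z| <= nm z.
Proof.
rewrite -sqrtr_sqr ler_wsqrtr // dotE -!expr2 lerDr.
by rewrite sqr_ge0.
Qed.

(** First-order expansion of the modulus with a quadratic error term, from sqrt (n^2 + s) <= n + s /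
    (2 n). *)
Lemma nm_step w d (e : R) : w != 0 ->
  nm (w - e%:C * d) <=
    nm w - e * dot (unitv w) d + e ^+ 2 * (dot d d / (2 * nm w)).
Proof.
move=> w0; have n0 := nm_gt0 w0; have n2 := nm_sqr w.
set q := (X in _ <= X).
have Q : dot (w - e%:C * d) (w - e%:C * d) =
    nm w ^+ 2 + (e ^+ 2 * dot d d - 2 * e * dot w d).
  by rewrite n2 !cplx; ring.
have qE : q = nm w + (e ^+ 2 * dot d d - 2 * e * dot w d) / (2 * nm w).
  rewrite /q unitvE dotZl; field.
  by rewrite gt_eqF.
have Q0 : 0 <= dot (w - e%:C * d) (w - e%:C * d) by exact: dot_ge0.
pose s := e ^+ 2 * dot d d - 2 * e * dot w d.
rewrite -/s in Q qE; rewrite Q in Q0.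
have q0 : 0 <= q.
  have -> : q = (nm w ^+ 2 + (nm w ^+ 2 + s)) / (2 * nm w).
    by rewrite qE; field; rewrite gt_eqF.
  by apply: divr_ge0; [rewrite addr_ge0 ?sqr_ge0|rewrite mulr_ge0 ?nm_ge0].
rewrite -(@ler_pXn2r _ 2%N) ?nnegrE ?nm_ge0 // nm_sqr Q.
have -> : q ^+ 2 = nm w ^+ 2 + s + (s / (2 * nm w)) ^+ 2.
  by rewrite qE; field; rewrite gt_eqF.
by rewrite lerDl sqr_ge0.
Qed.

Lemma geometric_median (n : nat) (v : 'I_n.+1 -> R[i]) :
  exists z, forall w, \sum_j nm (v j - z) <= \sum_j nm (v j - w).
Proof.
pose f (p : R * R) := \sum_j nm (v j - (p.1 +i* p.2)).
(* Twice the value at the origin: if |w| >= S, the distance from w to one vertex already reaches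
   that value. So a minimum over the square is global. *)
pose S := 2 * \sum_j nm (v j).
have cont : continuous f.
  apply: (@continuous_big R _ +%R 0 xpredT (@add_continuous R)) => j _ p.
  have -> : (fun q : R * R => nm (v j - (q.1 +i* q.2))) = (fun q : R * R =>
     Num.sqrt ((complex.Re (v j) - q.1) ^+ 2 + (complex.Im (v j) - q.2) ^+ 2)).
    by apply/funext => q; rewrite /nm !cplx.
  apply: (@continuous_comp _ _ _ (fun q : R * R =>
     (complex.Re (v j) - q.1) ^+ 2 + (complex.Im (v j) - q.2) ^+ 2)); last first.
    exact: sqrt_continuous.
  apply: cvgD; apply: (@cvg_comp _ _ _ _ (fun x : R => x ^+ 2)); try exact: exprn_continuous.
    by apply: cvgB; [exact: cvg_cst|exact: cvg_fst].
  by apply: cvgB; [exact: cvg_cst|exact: cvg_snd].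
have S0 : 0 <= S by rewrite mulr_ge0 // sumr_ge0 // => j _; exact: nm_ge0.
have K0 : (`[- S, S] `*` `[- S, S]) (0, 0).
  by split; rewrite /= in_itv /= oppr_le0 S0.
have [|||p pK pmin] := @compact_EVT_min (R * R)%type R f (`[- S, S] `*` `[- S, S]).
- by exists (0, 0).
- by apply: compact_setX; exact: segment_compact.
- exact: continuous_subspaceT.
exists (p.1 +i* p.2) => w; rewrite -/(f p).
have [wK|wK] := pselect ((`[- S, S] `*` `[- S, S]) (complex.Re w, complex.Im w)).
  have := pmin (complex.Re w, complex.Im w).
  by rewrite inE /f /=; case: (w) wK => a b /= ? H; exact: H.
apply: (@le_trans _ _ (f (0, 0))); first by apply: pmin; rewrite inE.
have Sw : S <= nm w.
  rewrite leNgt; apply/negP => wS; apply: wK; split; rewrite /= in_itv /= -ler_norml.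
    by rewrite (le_trans (Re_le_nm w)) // ltW.
  by rewrite (le_trans (Im_le_nm w)) // ltW.
have -> : f (0, 0) = \sum_j nm (v j).
  by apply: eq_bigr => j _; congr nm; rewrite /= subr0.
apply: (@le_trans _ _ (nm (v ord0 - w))); last first.
  by rewrite (bigD1 ord0) //= lerDl sumr_ge0 // => j _; exact: nm_ge0.
have : nm w <= nm (v ord0) + nm (v ord0 - w).
  have -> : w = v ord0 + - (v ord0 - w) by ring.
  by rewrite (le_trans (nmD _ _)) // nmN opprD opprK addNKr.
have : nm (v ord0) <= \sum_j nm (v j).
  by rewrite (bigD1 ord0) //= lerDl sumr_ge0 // => j _; exact: nm_ge0.
by move: Sw; rewrite /S; lra.
Qed.

Lemma le0_of_linear (g K : R) : 0 <= K -> (forall e, 0 < e -> g <= e * K) -> g <= 0.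
Proof.
move=> K0 H; rewrite leNgt; apply/negP => g0.
have K1 : 0 < K + 1 by lra.
have := H (g / (K + 1)); rewrite divr_gt0 // => /(_ isT).
rewrite mulrAC ler_pdivlMr //; lra.
Qed.

(** First-order condition at a minimum, valid even at a vertex. Moving by e d adds e |d| for each
    vertex at z, and [nm_step] bounds the other terms; then e tends to 0. *)
Lemma median_ineq (n : nat) (v : 'I_n.+1 -> R[i]) z :
  (forall w, \sum_j nm (v j - z) <= \sum_j nm (v j - w)) ->
  forall d, dot (\sum_(j | v j != z) unitv (v j - z)) d <=
            \sum_(j | v j == z) nm d.
Proof.
move=> zmin d; rewrite -subr_le0.
pose K := \sum_(j | v j != z) (dot d d / (2 * nm (v j - z))).
have K0 : 0 <= K.
  apply: sumr_ge0 => j _; rewrite divr_ge0 ?dot_ge0 // mulr_ge0 ?nm_ge0 //.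
apply: (le0_of_linear K0) => e e0.
have := zmin (z + e%:C * d).
have -> : \sum_j nm (v j - z) = \sum_(j | v j != z) nm (v j - z).
  rewrite (bigID (fun j => v j == z)) /= big1 ?add0r // => j /eqP ->.
  by rewrite subrr nm0.
have -> : \sum_j nm (v j - (z + e%:C * d)) = e * \sum_(j | v j == z) nm d +
    \sum_(j | v j != z) nm (v j - (z + e%:C * d)).
  rewrite (bigID (fun j => v j == z)) /= mulr_sumr; congr (_ + _).
  apply: eq_bigr => j /eqP ->.
  by rewrite opprD addrA subrr sub0r nmN nmZ // ltW.
have : \sum_(j | v j != z) nm (v j - (z + e%:C * d)) <=
   \sum_(j | v j != z) nm (v j - z) -
   e * dot (\sum_(j | v j != z) unitv (v j - z)) d + e ^+ 2 * K.
  rewrite dotC dot_sum !mulr_sumr -sumrN -!big_split /=; apply: ler_sum => j jz.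
  by rewrite opprD addrA [dot d _]dotC nm_step // subr_eq0.
move=> H1 H2; rewrite -(ler_pM2l e0).
by move: H1 H2; rewrite mulrBr expr2 mulrA; lra.
Qed.

Lemma dot_le1 z w : dot z z = 1 -> dot w w = 1 -> dot z w <= 1.
Proof.
move=> z1 w1; have := dot_cross_sqr z w; rewrite z1 w1 mulr1.
by have := sqr_ge0 (cross z w); nra.
Qed.


(* With p, q the unit vectors of v and v - x, the pairing of p - q with
   x = v - (v - x) is (|v| + |v - x|) (1 - p.q). *)
Lemma median_term v x : v != 0 -> v - x != 0 ->
  0 <= dot (unitv v - unitv (v - x)) x /\
  (dot (unitv v - unitv (v - x)) x = 0 -> cross x v = 0).
Proof.
move=> v0 w0; have := unitv_dot v0; have := unitv_dot w0.
have := nm_gt0 v0; have := nm_gt0 w0; have := unitvK v; have := unitvK (v - x).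
set p := unitv v; set q := unitv (v - x); set m := nm v; set n := nm (v - x).
move=> Ew Ev n0 m0 q1 p1.
have xE : x = m%:C * p - n%:C * q by rewrite -Ew -Ev; ring.
have E : dot (p - q) x = (m + n) * (1 - dot p q).
  transitivity (m * (dot p p - dot p q) + n * (dot q q - dot p q)).
    by rewrite xE !cplx; ring.
  by rewrite p1 q1; ring.
have pq := dot_le1 p1 q1.
split; first by rewrite E mulr_ge0 //; lra.
rewrite E => /eqP; rewrite mulf_eq0 gt_eqF ?addr_gt0 //= subr_eq0 => /eqP pq1.
have c0 : cross p q = 0.
  have := dot_cross_sqr p q; rewrite p1 q1 -pq1; nra.
rewrite xE Ev crossDl crossNl !crossZl !crossZr crosszz (crossC q) c0; ring.
Qed.

(** The nonnegative terms of [median_term] sum to 0, so each one vanishes. *)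
Lemma median_unique (n : nat) (v : 'I_n -> R[i]) x :
  (forall j, v j != 0) -> (forall j, v j - x != 0) ->
  \sum_j unitv (v j) = 0 -> \sum_j unitv (v j - x) = 0 ->
  forall j, cross x (v j) = 0.
Proof.
move=> v0 w0 S0 S1 j; have T k := median_term (v0 k) (w0 k).
have S : \sum_k dot (unitv (v k) - unitv (v k - x)) x = 0.
  rewrite (eq_bigr (fun k => dot x (unitv (v k) - unitv (v k - x)))).
    by rewrite -dot_sum sumrB S0 S1 subrr dot0.
  by move=> k _; rewrite dotC.
apply: (T j).2; move: S => /psumr_eq0P -> // k _; exact: (T k).1.
Qed.

End Median.

(** * The map on similarity classes *)

Section Similarity.
Variables (R : realType) (N : nat).
Implicit Types v L P : polygon R N.

Lemma similar_refl v : similar_polygons v v.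
Proof. by exists 1, 0; split=> [|i]; rewrite ?oner_eq0 // mul1r addr0. Qed.

Lemma similar_sym v v' : similar_polygons v v' -> similar_polygons v' v.
Proof.
move=> [c [d [c0 H]]]; exists c^-1, (- (c^-1 * d)); split=> [|i].
  by rewrite invr_eq0.
by rewrite H mulrDr mulKf // addrK.
Qed.

Lemma similar_trans v v' v'' : similar_polygons v v' -> similar_polygons v' v'' ->
  similar_polygons v v''.
Proof.
move=> [c [d [c0 H]]] [c' [d' [c'0 H']]]; exists (c' * c), (c' * d + d').
by split=> [|i]; rewrite ?mulf_neq0 // H' H; ring.
Qed.

Lemma similarity_class_eq v v' :
  similar_polygons v v' -> similarity_class v = similarity_class v'.
Proof.
move=> vv'; apply/seteqP; split=> w /=; last exact: similar_trans.
by apply: similar_trans; exact: similar_sym.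
Qed.

Lemma similar_side v v' (c d : R[i]) : (forall i, v' i = c * v i + d) ->
  forall i, side v' i = c * side v i.
Proof. by move=> H i; rewrite /side !H; ring. Qed.

Lemma similar_convex v v' : similar_polygons v v' ->
  strictly_convex_ccw v -> strictly_convex_ccw v'.
Proof.
move=> [c [d [c0 H]]] cv i j ji jS.
have -> : v' j - v' i = c * (v j - v i) by rewrite !H; ring.
by rewrite (similar_side H) crossM mulr_gt0 ?dot_gt0 // cv.
Qed.


Lemma sum_side v : \sum_j side v j = 0.
Proof. by rewrite sumrB [X in _ - X](reindex_inj (@ordS_inj N)) subrr. Qed.

Lemma convex_ge0 v i j : strictly_convex_ccw v ->
  0 <= cross (side v i) (v j - v i).
Proof.
move=> cv; have [->|ji] := eqVneq j i; first by rewrite subrr cross0.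
have [->|jS] := eqVneq j (ordS i); first by rewrite crosszz.
by rewrite ltW // cv.
Qed.

End Similarity.

(** * Well-definedness, injectivity and surjectivity *)

Section Main.
Variables (R : realType) (M : nat).
Local Notation N := M.+3.
Local Notation h := (step R M).
Local Notation A := (@regular_sunburst R N).
Implicit Types (v L P : polygon R N) (u w z c : R[i]).

Definition equilateral_convex L : Prop := strictly_convex_ccw L /\ equilateral L.

(** Supplies a vertex off side i, which exists because N >= 3. *)
Lemma ordSS_neq (i : 'I_N) : ordS (ordS i) != i /\ ordS (ordS i) != ordS i.
Proof.
have H (j : 'I_N) : ordS j != j.
  apply/eqP => /(congr1 val) /= E; have jN := ltn_ord j.
  have [j1|j1] := ltnP j.+1 N; move: E.
    by rewrite modn_small // => /eqP; rewrite -[X in _ == X]addn0 -addn1 eqn_add2l.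
  have -> : j.+1 = N by apply/eqP; rewrite eqn_leq jN.
  by rewrite modnn; lia.
split=> //; apply/eqP => /(congr1 val) /= E; have iN := ltn_ord i.
move: E; rewrite -[(i.+1 %% N).+1]addn1 modnDml addn1.
have [i2|] := ltnP i.+2 N; first by rewrite modn_small //; lia.
rewrite leq_eqVlt => /orP[/eqP Ni|i2]; first by rewrite -Ni modnn; lia.
have -> : i.+2 = (1 + N)%N by lia.
by rewrite modnDr modn_small //; lia.
Qed.

Lemma convex_side_neq0 v i : strictly_convex_ccw v -> side v i != 0.
Proof.
by move=> cv; have [h1 h2] := ordSS_neq i; exact: cross_neq0 (cv _ _ h1 h2).
Qed.

Lemma edge_unit L : strictly_convex_ccw L ->
  forall j, dot (edge_sunburst L j) (edge_sunburst L j) = 1.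
Proof. by move=> cL j; rewrite unitv_dot // convex_side_neq0. Qed.

(** With a common length, the edge directions are the sides up to one factor, and the sides of a
    closed polygon cancel. *)
Lemma edge_sum L : equilateral L -> \sum_j edge_sunburst L j = 0.
Proof.
move=> eL; rewrite (eq_bigr (fun j => side L j * `|side L ord0|^-1)).
  by rewrite -mulr_suml sum_side mul0r.
by move=> j _; rewrite /edge_sunburst /unitv (eL j ord0).
Qed.

Lemma edge_lift L : strictly_convex_ccw L ->
  exists phi, is_lift M phi (cyc (edge_sunburst L)).
Proof.
move=> /convex_lift[phi [l1 l2 l3]]; exists phi; split=> // n.
have [r r0 E] := l3 n; exists 1 => //.
by rewrite /cyc /edge_sunburst sideE E unitvZ // unitv_id ?cis_dot // mul1r.
Qed.

Lemma rotate_unit u (B : 'I_N -> R[i]) : dot u u = 1 ->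
  (forall j, dot (B j) (B j) = 1) -> forall j, dot (rotate u B j) (rotate u B j) = 1.
Proof. by move=> u1 B1 j; rewrite dotM u1 B1 mulr1. Qed.

Lemma rotation_unique (B : 'I_N -> R[i]) u u' t t' :
  (forall j, dot (B j) (B j) = 1) -> dot u u = 1 -> dot u' u' = 1 ->
  balanced (rotate u B) t -> balanced (rotate u' B) t' -> u = u'.
Proof.
move=> B1 u1 u'1 b b'; have u0 := unit_neq0 u1.
have w1 : dot (u' / u) (u' / u) = 1.
  by have := dotM u (u' / u) (u' / u); rewrite mulrC divfK // u1 u'1 mul1r.
have E : (fun j => u' / u * rotate u B j) = rotate u' B.
  by apply/funext => j; rewrite /rotate mulrA divfK.
rewrite -E in b'.
by have := balanced_rotation (rotate_unit u1 B1) w1 b b' => /divr1_eq.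
Qed.

(** The uniqueness clause of [is_PL] follows from [rotation_unique], so one dual pair suffices. *)
Lemma is_PL_intro L P u a : strictly_convex_ccw L -> dot u u = 1 ->
  dual_polygons A (rotate u (edge_sunburst L)) a P -> is_PL L P.
Proof.
move=> cL u1 D; exists u; split; last by exists a.
split; first by split; [exact/nm1P|exists a, P].
have E1 := edge_unit cL.
move=> u' [/nm1P u'1 [a' [P' D']]].
have [t b _] := dual_balanced (rotate_unit u1 E1) D.
have [t' b' _] := dual_balanced (rotate_unit u'1 E1) D'.
exact: rotation_unique E1 u1 u'1 b b'.
Qed.

Lemma is_PL_balanced L P : strictly_convex_ccw L -> is_PL L P ->
  exists u t, [/\ dot u u = 1, balanced (rotate u (edge_sunburst L)) t,
    forall j, P j = (t j)%:C * rotate u (edge_sunburst L) j,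
    strictly_convex_ccw P &
    forall j, positive_multiple (P j - P (ord_pred j)) (A j)].
Proof.
move=> cL [u [[[/nm1P u1 _] _] [a D]]].
have [t b E] := dual_balanced (rotate_unit u1 (edge_unit cL)) D.
by exists u, t; split=> //; case: D.
Qed.

Lemma PL_exists L : equilateral_convex L -> exists P, is_PL L P.
Proof.
move=> [cL eL]; have [phi lift] := edge_lift cL; have E1 := edge_unit cL.
have [x [t b]] := balanced_exists E1 (edge_sum eL) lift.
have u1 := cis_dot x; have r1 := rotate_unit u1 E1.
have lift' : is_lift M (fun n => x + phi n) (cyc (rotate (cis x) (edge_sunburst L))).
  have [l1 l2 l3] := lift; split=> n.
  - by rewrite l1; ring.
  - by have := l2 n; lra.
  - have [r r0 E] := l3 n; exists r => //.
    rewrite /cyc /rotate -/(cyc (edge_sunburst L) n) E cisD; ring.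
have [a D] := balanced_dual r1 b lift'.
by exists (fun j => (t j)%:C * rotate (cis x) (edge_sunburst L) j); exact: is_PL_intro D.
Qed.

(** A similarity with factor c turns the edge directions by [unitv c]. By uniqueness of the
    rotation, both rotated sunbursts coincide, and the solutions on one sunburst are
    proportional. *)
Lemma PL_similar L L' P P' : strictly_convex_ccw L -> similar_polygons L L' ->
  is_PL L P -> is_PL L' P' -> similar_polygons P P'.
Proof.
move=> cL LL' PL PL'; have cL' := similar_convex LL' cL.
have [u [t [u1 b E _ _]]] := is_PL_balanced cL PL.
have [u' [t' [u'1 b' E' _ _]]] := is_PL_balanced cL' PL'.
have [c [d [c0 H]]] := LL'.
have R' : rotate u' (edge_sunburst L') = rotate (u' * unitv c) (edge_sunburst L).
  apply/funext => j; rewrite /rotate /edge_sunburst (similar_side H) unitvM.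
  by rewrite mulrA.
have w1 : dot (u' * unitv c) (u' * unitv c) = 1 by rewrite dotM u'1 unitv_dot ?mulr1.
rewrite R' in b' E'.
have uE := rotation_unique (edge_unit cL) u1 w1 b b'.
rewrite -uE in b' E'.
have [k k0 kE] := balanced_proportional b b'.
exists k%:C, 0; split=> [|j].
  by apply/eqP => -[k0']; rewrite k0' ltxx in k0.
by rewrite E E' kE rmorphM addr0 mulrA.
Qed.

Lemma PL_map_class L P : equilateral_convex L -> is_PL L P ->
  PL_map (similarity_class L) = similarity_class P.
Proof.
move=> [cL eL] PL; apply/seteqP; split=> [w [L' LL' [P' PL' P'w]]|w Pw].
  exact: similar_trans (PL_similar cL LL' PL PL') P'w.
by exists L; [exact: similar_refl|exists P].
Qed.

Lemma PL_sides_lift P : (forall j, positive_multiple (P j - P (ord_pred j)) (A j)) ->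
  is_lift M (fun n => n.+1%:R * h) (fun n => cyc P n.+1 - cyc P n).
Proof.
move=> H; split=> n.
- by rewrite -addSn natrD mulrDl [N%:R * h]mulrC stepN.
- have := step_gt0 R M; have := step_lt_pi R M; rewrite -[n.+2%:R]natr1; lra.
- have [q q0 E] := H (ordS (inord (n %% N))); exists q => //.
  by rewrite -cyc_regular -(cycS A) -E ordSK cycS.
Qed.

Lemma PL_equiangular L P : strictly_convex_ccw L -> is_PL L P ->
  strictly_convex_ccw P /\ equiangular P.
Proof.
move=> cL PL; have [_ [_ [_ _ _ cP S]]] := is_PL_balanced cL PL.
split=> // i j; suff H k : interior_angle P k = pi - h by rewrite !H.
rewrite -(cyc_ord (interior_angle P)) -cycD addnS.
rewrite (lift_interior_angle _ (PL_sides_lift S)) -[X in X * h - _]natr1; ring.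
Qed.

Lemma cross_side_vertex v i z :
  cross (side v i) (z - v (ordS i)) = cross (side v i) (z - v i).
Proof.
have -> : z - v (ordS i) = (z - v i) - side v i by rewrite /side; ring.
by rewrite crossDr crossNr crosszz subr0.
Qed.

(* Only from the geometric median do the directions of the vertices of P cancel,
   so a similarity carries these directions along; up to a rotation, they are
   those of the sides of L. *)
Lemma PL_injective L L' P P' : equilateral_convex L -> equilateral_convex L' ->
  is_PL L P -> is_PL L' P' -> similar_polygons P P' -> similar_polygons L L'.
Proof.
move=> [cL eL] [cL' eL'] PL PL' [c [d [c0 H]]].
have [u [t [u1 b E cP _]]] := is_PL_balanced cL PL.
have [u' [t' [u'1 b' E' _ _]]] := is_PL_balanced cL' PL'.
have r1 := rotate_unit u1 (edge_unit cL); have r1' := rotate_unit u'1 (edge_unit cL').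
have [_ _ t0 _] := b; have [_ _ t'0 _] := b'.
have UP j : unitv (P j) = rotate u (edge_sunburst L) j.
  by rewrite E unitvZ ?unitv_id.
have UP' j : unitv (P' j) = rotate u' (edge_sunburst L') j.
  by rewrite E' unitvZ ?unitv_id.
have nz (k : R) z : 0 < k -> dot z z = 1 -> k%:C * z != 0.
  move=> k0 z1; apply: mulf_neq0; last exact: unit_neq0.
  by apply/eqP => -[k0']; rewrite k0' ltxx in k0.
have P0 j : P j != 0 by rewrite E nz.
(* [x] is the origin of the plane of P' pulled back to that of P; both 0 and [x] are then medians of
   P. *)
pose x := - (d / c).
have P'E j : P' j = c * (P j - x).
  by rewrite H /x opprK mulrDr mulrCA divff // mulr1.
have Px0 j : P j - x != 0.
  by have := nz _ _ (t'0 j) (r1' j); rewrite -E' P'E mulf_eq0 negb_or => /andP[].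
have S0 : \sum_j unitv (P j) = 0.
  by rewrite (eq_bigr _ (fun j _ => UP j)) -mulr_sumr edge_sum ?mulr0.
have S1 : \sum_j unitv (P j - x) = 0.
  have c1 : unitv c != 0 by rewrite unit_neq0 ?unitv_dot.
  apply: (mulfI c1); rewrite mulr0 mulr_sumr.
  rewrite (eq_bigr (fun j => rotate u' (edge_sunburst L') j)).
    by rewrite -mulr_sumr edge_sum ?mulr0.
  by move=> j _; rewrite -unitvM -P'E UP'.
have X0 := median_unique P0 Px0 S0 S1.
(* Otherwise all vertices of P would lie on the line through 0 and [x], against strict convexity. *)
have x0 : x = 0.
  apply/eqP; apply/negPn/negP => xn0.
  have [h1 h2] := ordSS_neq (ord0 : 'I_N); have := cP _ _ h1 h2.
  suff -> : cross (side P ord0) (P (ordS (ordS ord0)) - P ord0) = 0 by rewrite ltxx.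
  have par y z : cross x y = 0 -> cross x z = 0 -> cross y z = 0.
    move=> xy xz; apply: (mulIf (lt0r_neq0 (dot_gt0 xn0))).
    have -> : cross y z * dot x x = dot x y * cross x z - cross x y * dot x z.
      by rewrite !cplx; ring.
    by rewrite xy xz !mul0r mulr0 subr0.
  by apply: par; rewrite /side crossDr crossNr !X0 subrr.
have EE j : edge_sunburst L' j = u'^-1 * unitv c * u * edge_sunburst L j.
  have : unitv (P' j) = unitv c * unitv (P j) by rewrite P'E x0 subr0 unitvM.
  rewrite UP UP' /rotate => E1.
  apply: (mulfI (unit_neq0 u'1)); rewrite E1 !mulrA mulfV ?mul1r //.
  exact: unit_neq0.
pose r := nm (side L ord0); pose r' := nm (side L' ord0).
have r0 : 0 < r by rewrite nm_gt0 // convex_side_neq0.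
have r'0 : 0 < r' by rewrite nm_gt0 // convex_side_neq0.
have sL j : side L j = r%:C * edge_sunburst L j.
  rewrite [LHS]unitvK; congr (_%:C * _).
  by apply: complexI; rewrite -!normE; exact: eL.
have sL' j : side L' j = r'%:C * edge_sunburst L' j.
  rewrite [LHS]unitvK; congr (_%:C * _).
  by apply: complexI; rewrite -!normE; exact: eL'.
have rC0 : r%:C != 0 by apply/eqP => -[r00]; rewrite r00 ltxx in r0.
have rC0' : r'%:C != 0 by apply/eqP => -[r00]; rewrite r00 ltxx in r'0.
apply: (@similar_of_sides _ _ _ _ (r'%:C / r%:C * (u'^-1 * unitv c * u))).
  apply: mulf_neq0; first by rewrite mulf_neq0 ?invr_eq0.
  apply: mulf_neq0; last exact: unit_neq0.
  apply: mulf_neq0; first by rewrite invr_eq0 unit_neq0.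
  by apply: unit_neq0; exact: unitv_dot.
move=> j; rewrite sL sL' EE.
move: (u'^-1 * unitv c * u) (r%:C) (r'%:C) (edge_sunburst L j) rC0 => k s s' e s0.
by rewrite mulrACA divfK // mulrA.
Qed.

(** Equal interior angles mean equal turns, and N equal turns with total 2 pi are turns by [h]. *)
Lemma equiangular_sides v : strictly_convex_ccw v -> equiangular v ->
  exists2 c, dot c c = 1 &
    forall j, positive_multiple (side v j) (c * A (ordS j)).
Proof.
move=> cv ev; have [phi lift] := convex_lift cv; have [l1 l2 l3] := lift.
have gap n : phi n.+1 = phi n + (phi 1%N - phi 0%N).
  have := lift_interior_angle n lift; have := lift_interior_angle 0 lift.
  by rewrite /cyc (ev (inord (n.+1 %% N)) (inord (1 %% N))); lra.
have phiE n : phi n = phi 0%N + n%:R * (phi 1%N - phi 0%N).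
  elim: n => [|n IH]; first by rewrite mul0r addr0.
  by rewrite gap IH -natr1; ring.
have gE : phi 1%N - phi 0%N = h.
  have := l1 0%N; rewrite add0n phiE -(stepN R M) => /addrI E.
  by apply: (@mulfI _ N%:R); rewrite ?pnatr_eq0 // E mulrC.
(* The shift by [h] appears because side 0 is matched with A_1, of argument [h]. *)
exists (cis (phi 0%N - h)); first exact: cis_dot.
move=> j; have [r r0 E] := l3 j; exists r => //.
rewrite -(cyc_ord (side v)) cyc_side E regularSE -cisD phiE gE; congr (_ * cis _).
by ring.
Qed.

(** The hypotheses put w in the cone spanned by A_(k+1) and - A_k, of opening pi - h. Its bisector
    makes the angle (pi - h) / 2, with cosine sin (h / 2), with both edges. *)
Lemma cone_dot (k : 'I_N) w : 0 <= cross (A k) w -> 0 <= cross (A (ordS k)) w ->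
  sin (h / 2) * nm w <= dot w (cis (k%:R * h + h / 2 + pi / 2)).
Proof.
move=> c1 c2; set d := cis _; have s0 := sin_step R M.
have s20 : 0 <= sin (h / 2).
  by apply: sin_ge0_pi; have := step_gt0 R M; have := step_lt_pi R M; lra.
pose l := cross (A k) w / sin h; pose m := cross (A (ordS k)) w / sin h.
have l0 : 0 <= l by rewrite divr_ge0 // ltW.
have m0 : 0 <= m by rewrite divr_ge0 // ltW.
have wE : w = l%:C * A (ordS k) + m%:C * - A k.
  have sn0 : (sin h)%:C != 0 by apply/eqP => -[E]; rewrite E ltxx in s0.
  apply: (mulfI sn0); rewrite mulrDr !mulrA -!rmorphM /l /m.
  rewrite ![sin h * _]mulrC !divfK ?gt_eqF // -(cross_regular _ k).
  exact: cramer.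
have dE : dot w d = (l + m) * sin (h / 2).
  rewrite wE dotC dotDr !dotZr dotNr regularSE regularE !dot_cis.
  have -> : k%:R * h + h - (k%:R * h + h / 2 + pi / 2) = h / 2 - pi / 2 by field.
  have -> : k%:R * h - (k%:R * h + h / 2 + pi / 2) = - (h / 2 + pi / 2) by ring.
  by rewrite cosN cosBpihalf cosDpihalf; ring.
rewrite dE mulrC ler_wpM2r // [X in nm X]wE (le_trans (nmD _ _)) //.
rewrite !nmZ // nmN.
have n1 j : nm (A j) = 1 by rewrite /nm regular_dot sqrtr1.
by rewrite !n1 !mulr1.
Qed.

(* Along the bisector of the angle at v k, the N-1 other vertices pull the median
   away with a total force of at least (N-1) sin (pi/N) > 1. *)
Lemma median_not_vertex v z : strictly_convex_ccw v ->
  (forall j, positive_multiple (side v j) (A (ordS j))) ->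
  (forall w, \sum_j nm (v j - z) <= \sum_j nm (v j - w)) ->
  forall k, v k - z != 0.
Proof.
move=> cv sv zmin k; rewrite subr_eq0; apply/eqP => vk.
have inj j : (v j == z) = (j == k).
  apply/eqP/eqP => [|-> //]; rewrite -vk => E; apply/eqP/negPn/negP => jk.
  have [jS|jS] := eqVneq j (ordS k).
    by have := convex_side_neq0 k cv; rewrite /side -jS E subrr eqxx.
  by have := cv k j jk jS; rewrite E subrr cross0 ltxx.
pose d : R[i] := cis (k%:R * h + h / 2 + pi / 2).
have d1 : nm d = 1 by rewrite /nm cis_dot sqrtr1.
have := median_ineq zmin d; rewrite d1 (eq_bigl _ _ inj) big_pred1_eq.
rewrite dotC dot_sum; apply/negP; rewrite -ltNge.
have term j : v j != z -> sin (h / 2) <= dot d (unitv (v j - z)).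
  move=> jz; have w0 : v j - z != 0 by rewrite subr_eq0.
  rewrite unitvE dotZr dotC [_^-1 * _]mulrC ler_pdivlMr ?nm_gt0 //.
  apply: cone_dot.
    have [q q0 E] := sv (ord_pred k); rewrite ord_predK in E.
    have := convex_ge0 (ord_pred k) j cv.
    by rewrite -cross_side_vertex ord_predK vk E crossZl pmulr_rge0.
  have [q q0 E] := sv k.
  by rewrite -(pmulr_rge0 _ q0) -crossZl -E -vk convex_ge0.
apply: lt_le_trans (ler_sum _ term).
have -> : \sum_(j | v j != z) sin (h / 2) = (N%:R - 1) * sin (h / 2).
  have : \sum_(j < N) sin (h / 2) = N%:R * sin (h / 2).
    by rewrite sumr_const card_ord mulr_natl.
  rewrite (bigID (fun j => v j == z)) /= (eq_bigl _ _ inj) big_pred1_eq; lra.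
have J : h < pi * sin (h / 2).
  have /jordan_sin : 0 < h / 2 < pi / 2.
    by have := step_gt0 R M; have := step_lt_pi R M; lra.
  by lra.
have n3 : 3 <= N%:R :> R by rewrite ler_nat.
have := stepN R M; move: J n3; have := @pi_gt0 R; have := step_gt0 R M.
move: (sin _) (N%:R) => s n h0 p0 J n3 hn.
(* From h < pi s and h n = 2 pi. If s <= 1, then (n - 1) s > 2 - 1; if s > 1, then n >= 3 gives (n -
   1) s >= 2 s. *)
have ns : 2 < n * s.
  rewrite -(ltr_pM2l p0) [pi * 2]mulrC -hn mulrCA [h * n]mulrC ltr_pM2l //; lra.
have s0 : 0 < s by rewrite -(pmulr_rgt0 _ p0); lra.
have : 0 <= (n - 3) * s by rewrite mulr_ge0 //; lra.
have [s1|s1] := leP s 1; lra.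
Qed.

(** If z were on or beyond the line of side i, all unit vectors from z to the vertices would point
    weakly to the left of this side, and the one to vertex i + 2 strictly, so they could not
    cancel. *)
Lemma median_inside v z : strictly_convex_ccw v ->
  (forall j, v j - z != 0) -> \sum_j unitv (v j - z) = 0 ->
  forall i, 0 < cross (side v i) (z - v i).
Proof.
move=> cv v0 S0 i; rewrite ltNge; apply/negP => le0.
have T j : cross (side v i) (v j - z) =
    cross (side v i) (v j - v i) - cross (side v i) (z - v i).
  by rewrite -crossNr -crossDr; congr cross; ring.
have C0 : \sum_j cross (side v i) (unitv (v j - z)) = 0.
  by rewrite -cross_sum S0 cross0.
have ge0 j : 0 <= cross (side v i) (unitv (v j - z)).
  rewrite unitvE crossZr mulr_ge0 ?invr_ge0 ?nm_ge0 // T.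
  by have := convex_ge0 i j cv; lra.
have [h1 h2] := ordSS_neq i; have := cv _ _ h1 h2.
move: C0 => /psumr_eq0P C0.
have := cross_unitvr (side v i) (v (ordS (ordS i)) - z).
by rewrite C0 // mulr0 T; lra.
Qed.

Lemma PL_surjective v : strictly_convex_ccw v -> equiangular v ->
  exists L P, [/\ equilateral_convex L, is_PL L P & similar_polygons v P].
Proof.
move=> cv ev; have [c c1 sv] := equiangular_sides cv ev; have c0 := unit_neq0 c1.
pose v1 : polygon R N := fun j => c^-1 * v j.
have [z zmin] := geometric_median v1.
have vv1 : similar_polygons v v1.
  by exists c^-1, 0; split=> [|j]; rewrite ?invr_eq0 // addr0.
have cv1 := similar_convex vv1 cv.
have sv1 j : positive_multiple (side v1 j) (A (ordS j)).
  have [q q0 E] := sv j; exists q => //.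
  have -> : side v1 j = c^-1 * side v j by rewrite /side /v1; ring.
  by rewrite E mulrCA mulKf.
have b0 := median_not_vertex cv1 sv1 zmin.
have S0 : \sum_j unitv (v1 j - z) = 0.
  have vz j : (v1 j == z) = false by rewrite -subr_eq0; exact: negbTE.
  (* As no vertex is at z, testing the first-order condition on the sum itself gives |G|^2 <= 0. *)
  set G := \sum_j _; have := median_ineq zmin G.
  rewrite (eq_bigl xpredT) => [|j]; last by rewrite vz.
  rewrite [X in _ <= X]big_pred0 // => G0.
  by apply/eqP; rewrite -dot_eq0 eq_le G0 dot_ge0.
have ins := median_inside cv1 b0 S0.
pose b : polygon R N := fun j => v1 j - z.
pose B j := unitv (b j); pose t j := nm (b j).
have bE j : b j = (t j)%:C * B j by exact: unitvK.
have t0 j : 0 < t j by rewrite nm_gt0 // b0.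
have B1 j : dot (B j) (B j) = 1 by rewrite unitv_dot // b0.
have sb j : side b j = side v1 j by rewrite /side /b; ring.
(* The median is left of the side leaving vertex j, along A_(j+1), and of the side entering it,
   along A_j: these are the two sector conditions. *)
have Y0 j : 0 < cross (B j) (A (ordS j)).
  have [q q0 E] := sv1 j; rewrite -(pmulr_rgt0 _ (t0 j)) -crossZl -bE.
  rewrite -(pmulr_rgt0 _ q0) -crossZr -E crossC -crossNr opprB; exact: ins.
have X0 j : 0 < cross (B j) (A j).
  have [q q0 E] := sv1 (ord_pred j); rewrite ord_predK in E.
  rewrite -(pmulr_rgt0 _ (t0 j)) -crossZl -bE.
  rewrite -(pmulr_rgt0 _ q0) -crossZr -E crossC -crossNr opprB.
  by rewrite -[j in v1 j]ord_predK cross_side_vertex; exact: ins.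
have bS j : exists2 q, 0 < q & b (ordS j) = b j + q%:C * A (ordS j).
  by have [q q0 E] := sv1 j; exists q => //; rewrite -E -sb /side addrC subrK.
have bal : balanced B t.
  split=> // j; have [q q0 E] := bS j.
  by rewrite -!crossZl -!bE E crossDl crossZl crosszz mulr0 addr0.
have BB j : 0 < cross (B j) (B (ordS j)).
  have [q q0 E] := bS j.
  rewrite -(pmulr_rgt0 _ (t0 j)) -crossZl -bE -(pmulr_rgt0 _ (t0 (ordS j))).
  rewrite -crossZr -bE E crossDr crosszz add0r crossZr mulr_gt0 //.
  by rewrite bE crossZl mulr_gt0.
have [phi lift] := sectors_lift B1 X0 Y0 BB.
(* The unit vectors from the median to the vertices, laid end to end, close up to the polygon [L];
   the lift of their arguments shows that it is convex. *)
have [L LE] := polygon_of_sides S0.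
have cL : strictly_convex_ccw L.
  apply: (@lift_convex _ _ _ phi); have [l1 l2 l3] := lift; split=> // n.
  by have [r r0 E] := l3 n; exists r; rewrite // -sideE LE.
have [a D] := balanced_dual B1 bal lift.
exists L, b; split.
- split=> // i j; rewrite !LE; have /nm1P -> := B1 i; by have /nm1P -> := B1 j.
- apply: (@is_PL_intro L b 1 a) => //; first by rewrite !cplx; ring.
  have -> : rotate 1 (edge_sunburst L) = B.
    by apply/funext => j; rewrite /rotate mul1r /edge_sunburst LE; exact/unitv_id/B1.
  by have -> : b = (fun j => (t j)%:C * B j) by apply/funext => j; exact: bE.
- by exists c^-1, (- z); split=> [|j]; rewrite ?invr_eq0.
Qed.

End Main.

Theorem mainTheorem5 (R : realType) (N : nat) (hN : (3 <= N)%N) :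
  set_bij (equilateral_classes R N) (equiangular_classes R N) (@PL_map R N).
Proof.
case: N hN => [|[|[|M]]] // _; split.
- move=> _ [L eL <-]; have [P PL] := PL_exists eL.
  exists P; first exact: PL_equiangular (eL.1) PL.
  by rewrite (PL_map_class eL PL).
- move=> _ _ /set_mem[L eL <-] /set_mem[L' eL' <-].
  have [P PL] := PL_exists eL; have [P' PL'] := PL_exists eL'.
  rewrite (PL_map_class eL PL) (PL_map_class eL' PL') => E.
  apply: similarity_class_eq; apply: (PL_injective eL eL' PL PL').
  by have : similarity_class P' P' by [exact: similar_refl]; rewrite -E.
- move=> _ [v [cv ev] <-]; have [L [P [eL PL vP]]] := PL_surjective cv ev.
  exists (similarity_class L); first by exists L.
  by rewrite (PL_map_class eL PL) (similarity_class_eq vP).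
Qed.
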